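(* Let $d\in\mathbb{N}$ and let $f=h(\mathfrak{p}_1,\ldots,\mathfrak{p}_{2d})\in\Theta$ be a normalized symmetric function, where $h$ is a real polynomial in $2d$ variables. (1) If there exists $\varepsilon>0$ with $f^{(n)}\geq\varepsilon$ (on $\mathbb{R}^n$) for all $n\in\mathbb{N}$, then there are sums of squares $p,q\in\Theta$ with $pf=1+q$. (2) If $f^{(n)}\geq 0$ (on $\mathbb{R}^n$) for all $n\in\mathbb{N}$, then there are sums of squares $p,q\in\Theta$ and an integer $m\geq 0$ with $pf=f^{2m}+q$.
   Context: $\mathbb{N}$ denotes the positive integers. For $k,n\in\mathbb{N}$ let $p_k^{(n)}=\sum_{i=1}^n X_i^k$; $\frac{1}{n}p_k^{(n)}$ is the $k$-th power mean in $n$ variables. $\Theta=\mathbb{R}[\mathfrak{p}_1,\mathfrak{p}_2,\ldots]$ is the polynomial ring in algebraically independent variables $\mathfrak{p}_1,\mathfrak{p}_2,\ldots$ (of degrees $1,2,\ldots$), called the ring of normalized symmetric functions. An element $f=g(\mathfrak{p}_1,\ldots,\mathfrak{p}_D)\in\Theta$ is identified with the sequence of symmetric polynomials $f^{(n)}=g\left(\frac{p_1^{(n)}}{n},\ldots,\frac{p_D^{(n)}}{n}\right)\in\mathbb{R}[X_1,\ldots,X_n]$, $n\in\mathbb{N}$. An element $f\in\Theta$ is called a sum of squares (sos) if, for every $n\in\mathbb{N}$, $f^{(n)}$ is a sum of squares of polynomials in $\mathbb{R}[X_1,\ldots,X_n]$ (it is not required to be a sum of squares of elements of $\Theta$). 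*)

(* Defs.v *)
From HB Require Import structures.
From mathcomp Require Export all_boot all_order all_algebra.
From mathcomp Require Export finmap reals monalg mpoly.

Set Implicit Arguments.
Unset Strict Implicit.
Unset Printing Implicit Defensive.

Import GRing.Theory.

Local Open Scope ring_scope.

(* Both monalg and mpoly define {mpoly R[n]}, and they also share the names
   mmap, mcoeff and msupp.  Here they all denote the versions of mpoly; a later
   import of monalg would change the meaning of {mpoly R[n]}. *)
Notation "{ 'mpoly' T [ n ] }" := (mpoly n T) : type_scope.

(* R[p_1, p_2, ...] is the monoid algebra of the commutative monomials over
   nat.  Indices are shifted: the variable of index k : nat is p_(k+1). *)
Notation Theta R := {malg R[{cmonom nat}]}.

Definition pvar (R : realType) (k : nat) : Theta R := mkmalgU (ucm k) 1.

Definition power_sum (R : realType) (n k : nat) : {mpoly R[n]} :=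
  \sum_(i < n) 'X_i ^+ k.

Definition power_mean (R : realType) (n k : nat) : {mpoly R[n]} :=
  n%:R^-1 *: power_sum R n k.

(* f^(n), obtained from f by replacing each p_(k+1) with the power mean of
   exponent k+1 in n variables. *)
Definition realize (R : realType) (n : nat) (f : Theta R) : {mpoly R[n]} :=
  monalg.mmap (@mpolyC n R)
    (fun m : {cmonom nat} =>
       \prod_(k <- finsupp m) power_mean R n k.+1 ^+ m k) f.

Definition is_sos_poly (R : realType) (n : nat) (g : {mpoly R[n]}) : Prop :=
  exists s : seq {mpoly R[n]}, g = \sum_(u <- s) u ^+ 2.

Definition is_sos (R : realType) (f : Theta R) : Prop :=
  forall n : nat, (0 < n)%N -> is_sos_poly (realize n f).

(* h(p_1, ..., p_D); the constants of R are embedded in Theta R by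
   c |-> mkmalgU mone c. *)
Definition subst_pvar (R : realType) (D : nat) (h : {mpoly R[D]}) : Theta R :=
  mmap (@mkmalgU {cmonom nat} R mone) (fun i : 'I_D => pvar R i) h.

(* Main.v *)
(* Over Theta, let T be the preordering of the sums of squares lying in
   R[p_1,...,p_2d]. If no certificate exists, a maximal preordering containing T
   and -f yields an ordered field K and a point of K^2d at which f <= 0 (f < 0 in
   the second case). Realized in n variables, the Hankel form sum w_i w_j p_(i+j)
   is the average over l of (sum w_i X_l^i)^2, so it lies in T and the Hankel
   matrix of the point is positive semidefinite over K. Writing it as
   sum_k c_k l_k l_k^T with c_k >= 0 turns this into finitely many polynomial
   equations and sign conditions, which Tarski's transfer principle (Sturm's
   theorem, inside a real closure of K) moves to R.

   A real sequence with positive semidefinite Hankel matrix is a limit of power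
   means: otherwise a hyperplane separates it from the moment curve, giving a
   nonnegative univariate polynomial, hence a sum of squares, on which the moment
   functional is negative. By continuity f >= eps (resp. f >= 0) at that real
   point, a contradiction. *)

From HB Require Import structures.
Require Import Defs.
From mathcomp Require Import boolp classical_sets.
From mathcomp Require Import ring_quotient fraction generic_quotient.
From mathcomp Require Import qe_rcf_th polyrcf complex.
From mathcomp Require Import zify ring lra.

Set Implicit Arguments.
Unset Strict Implicit.
Unset Printing Implicit Defensive.

Import Order.TTheory GRing.Theory Num.Theory.

Local Open Scope ring_scope.

(** * Orderings and residue fields *)

(** At level n the squares live in n variables, may change with n and need not come from [Theta], so
    [T] is not tied to finitely many generators. It enters only through its closure properties and
    the Hankel forms it contains. The ordered field [K] is therefore abstract and possibly
    non-archimedean, and bounds at real points say nothing about it directly.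

    Transfer moves existential statements in finitely many unknowns, whereas positive
    semidefiniteness quantifies over all vectors; the decomposition into c_k l_k l_k^T makes it
    existential. It exists over [K] itself because no square root is extracted.

    The passage from a preordering to an ordered field is the one tool behind every field built
    here: a root of one polynomial, roots of all polynomials at once, the limit of the resulting
    tower, and [K]. Avoiding all -s^(2m) instead of -1 alone keeps s nonzero in the field: s = 1
    serves the first claim, s = h the second, where a strict sign is needed. *)

Definition preordering (A : comNzRingType) (T : A -> Prop) :=
  [/\ forall x y, T x -> T y -> T (x + y),
      forall x y, T x -> T y -> T (x * y)
    & forall x, T (x ^+ 2)].

(** For [s = 1] this is properness of [T]; in general it is properness after inverting [s]. *)
Definition avoids_even_powers (A : comNzRingType) (s : A) (T : A -> Prop) :=
  forall m : nat, ~ T (- s ^+ (2 * m)).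

Definition in_support (A : comNzRingType) (T : A -> Prop) (x : A) :=
  T x /\ T (- x).

Lemma preordering_adjoin (A : comNzRingType) (T : A -> Prop) (a : A) :
  preordering T ->
  preordering (fun x => exists t u, [/\ T t, T u & x = t + a * u]).
Proof.
case=> TD TM TX; split.
- move=> _ _ [t [u [Tt Tu ->]]] [t' [u' [Tt' Tu' ->]]].
  by exists (t + t'), (u + u'); split; [apply/TD|apply/TD|ring].
- move=> _ _ [t [u [Tt Tu ->]]] [t' [u' [Tt' Tu' ->]]].
  exists (t * t' + a ^+ 2 * (u * u')), (t * u' + u * t').
  split; [apply: (TD _ _ (TM _ _ _ _)) => //|by apply/TD; apply/TM|by ring].
  by apply: (TM _ _ (TX _)); apply/TM.
- move=> x; exists (x ^+ 2), (0 ^+ 2).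
  by split; [exact: TX|exact: TX|ring].
Qed.

(** Zorn's lemma. The last clause is what maximality yields, because the elements [t + a * u] form a
    preordering containing [M] and [a]. *)
Lemma maximal_preordering (A : comNzRingType) (T : A -> Prop) (s : A) :
  preordering T -> avoids_even_powers s T ->
  exists M : A -> Prop,
    [/\ preordering M, avoids_even_powers s M, forall x, T x -> M x
      & forall a, ~ M a ->
          exists m t u, [/\ M t, M u & - s ^+ (2 * m) = t + a * u]].
Proof.
move=> pT sT; have [TD TM TX] := pT.
(* Joining [T] to every set covers the empty chain: its union is empty, and [ext] of it is [T]. *)
pose ext (M : set A) : A -> Prop := fun x => T x \/ M x.
pose good (M : set A) := preordering (ext M) /\ avoids_even_powers s (ext M).
have [|M [[pM sM] Mmax]] := @Zorn_bigcup A good.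
  move=> F Fgood Ftot.
  have pick x y : ext (\bigcup_(X in F) X)%classic x ->
      ext (\bigcup_(X in F) X)%classic y ->
      (T x /\ T y) \/ exists2 X, F X & ext X x /\ ext X y.
    move=> [Tx|[X FX Xx]] [Ty|[Y FY Yy]].
    - by left.
    - by right; exists Y => //; split; [left|right].
    - by right; exists X => //; split; [right|left].
    - right; case: (Ftot _ _ FX FY) => sub.
        by exists Y => //; split; right => //; apply: sub.
      by exists X => //; split; right => //; apply: sub.
  have incl X x : F X -> ext X x -> ext (\bigcup_(X in F) X)%classic x.
    by move=> FX [Tx|Xx]; [left|right; exists X].
  split; first split.
  - move=> x y ex ey; case: (pick x y ex ey) => [[Tx Ty]|[X FX [Xx Xy]]].
      by left; apply/TD.
    by apply: (incl X) => //; case: (Fgood X FX) => -[h _ _] _; apply: h.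
  - move=> x y ex ey; case: (pick x y ex ey) => [[Tx Ty]|[X FX [Xx Xy]]].
      by left; apply/TM.
    by apply: (incl X) => //; case: (Fgood X FX) => -[_ h _] _; apply: h.
  - by move=> x; left.
  - move=> m ex; case: (pick _ _ ex ex) => [[Tx _]|[X FX [Xx _]]].
      exact: (sT m).
    by case: (Fgood X FX) => _ /(_ m).
exists (ext M); split => //; first by left.
move=> a Ma; apply: contrapT => nex.
have [MD MM MX] := pM.
pose B : set A := fun x => exists t u, [/\ ext M t, ext M u & x = t + a * u].
have M0 : ext M 0 by have := MX 0; rewrite expr0n.
have extB x : ext B x -> B x.
  case=> // Tx; exists x, 0; split=> //; first by left.
  by rewrite mulr0 addr0.
have eB : ext B = B :> (A -> Prop).
  by apply: funext => x; apply: propext; split; [exact: extB|right].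
apply: (Mmax B).
  split.
    move=> x Mx; exists x, 0; split=> //; first by right.
    by rewrite mulr0 addr0.
  move=> sub; apply: Ma; right; apply: sub.
  exists 0, 1; split=> //; last by rewrite add0r mulr1.
  by have := MX 1; rewrite expr1n.
split; rewrite eB; first exact: preordering_adjoin.
by move=> m [t [u [Mt Mu e]]]; apply: nex; exists m, t, u.
Qed.

(** For [a], [b] outside the maximal [P], the two relations given by maximality multiply to [a * b *
    (u1 * u2) = s ^+ (2 * (m1 + m2)) + t] with [t] in [P]. Taking [b = - a] contradicts avoidance,
    so [P] is total. If [a * b] lay in the support, so would the right-hand side, again a
    contradiction, so the support is prime. *)
Lemma prime_cone_exists (A : comNzRingType) (T : A -> Prop) (s : A) :
  preordering T -> avoids_even_powers s T ->
  exists P : A -> Prop,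
    [/\ preordering P /\ avoids_even_powers s P, forall x, T x -> P x,
        forall x, P x \/ P (- x), ~ in_support P s
      & forall x y, in_support P (x * y) -> in_support P x \/ in_support P y].
Proof.
move=> pT sT; have [P [pP sP TP Pmax]] := maximal_preordering pT sT.
have [PD PM PX] := pP.
have P0 : P 0 by have := PX 0; rewrite expr0n.
have Pse m : P (s ^+ (2 * m)) by rewrite exprM exprAC; apply/PX.
have prod m1 t1 u1 a m2 t2 u2 b :
    P t1 -> P u1 -> - s ^+ (2 * m1) = t1 + a * u1 ->
    P t2 -> P u2 -> - s ^+ (2 * m2) = t2 + b * u2 ->
    exists2 t, P t & a * b * (u1 * u2) = s ^+ (2 * (m1 + m2)) + t.
  move=> Pt1 Pu1 e1 Pt2 Pu2 e2.
  exists (s ^+ (2 * m1) * t2 + t1 * s ^+ (2 * m2) + t1 * t2).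
    by apply/PD; [apply/PD|]; apply/PM.
  have -> : a * b * (u1 * u2) = (a * u1) * (b * u2) by ring.
  have -> : a * u1 = - s ^+ (2 * m1) - t1 by rewrite e1; ring.
  have -> : b * u2 = - s ^+ (2 * m2) - t2 by rewrite e2; ring.
  by rewrite mulnDr exprD; ring.
have Ptot x : P x \/ P (- x).
  apply: contrapT => /not_orP[nx nxN].
  have [m1 [t1 [u1 [Pt1 Pu1 e1]]]] := Pmax _ nx.
  have [m2 [t2 [u2 [Pt2 Pu2 e2]]]] := Pmax _ nxN.
  have [t Pt e] := prod _ _ _ _ _ _ _ _ Pt1 Pu1 e1 Pt2 Pu2 e2.
  apply: (sP (m1 + m2)%N).
  have -> : - s ^+ (2 * (m1 + m2)) = t + x ^+ 2 * (u1 * u2).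
    have -> : s ^+ (2 * (m1 + m2)) = x * - x * (u1 * u2) - t by rewrite e; ring.
    by ring.
  by apply/PD => //; apply: (PM _ _ (PX _)); apply/PM.
have suppM x y : in_support P x -> in_support P (x * y).
  move=> [Px PNx]; case: (Ptot y) => Py; split; rewrite -?mulNr; try exact: PM.
    by rewrite -mulrNN; apply/PM.
  by rewrite mulNr -mulrN; apply/PM.
exists P; split=> //.
  move=> ss; have [_] := suppM _ s ss.
  by rewrite -expr2 -[2%N]muln1; exact: sP.
move=> x y xy; apply: contrapT => /not_orP[nx ny].
(* Outside the support, [z] or [- z] is outside [P]; the choice of sign is harmless because the
   support is stable under negation. *)
have sg z : ~ in_support P z -> exists2 z', (z' = z \/ z' = - z) & ~ P z'.
  move=> nz; case: (pselect (P z)) => Pz; last by exists z => //; left.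
  by exists (- z); [right|move=> PNz; apply: nz].
have [x' ex nx'] := sg _ nx; have [y' ey ny'] := sg _ ny.
have [m1 [t1 [u1 [Pt1 Pu1 e1]]]] := Pmax _ nx'.
have [m2 [t2 [u2 [Pt2 Pu2 e2]]]] := Pmax _ ny'.
have [t Pt e] := prod _ _ _ _ _ _ _ _ Pt1 Pu1 e1 Pt2 Pu2 e2.
have sxy' : in_support P (x' * y').
  have sN z : in_support P z -> in_support P (- z).
    by case=> p q; split; rewrite ?opprK.
  by case: ex => ->; case: ey => ->; rewrite ?mulrNN // ?mulNr ?mulrN; apply: sN.
have [_] := suppM _ (u1 * u2) sxy'; rewrite e => PN.
apply: (sP (m1 + m2)%N).
have -> : - s ^+ (2 * (m1 + m2)) = - (s ^+ (2 * (m1 + m2)) + t) + t by ring.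
exact: PD.
Qed.

(** * The residue field of a prime cone *)

Section ConeQuotient.
Local Open Scope quotient_scope.
Variables (A : comNzRingType) (P : A -> Prop).
Hypotheses (pP : preordering P) (Ptot : forall x, P x \/ P (- x)).
Hypothesis P1 : ~ in_support P 1.
Hypothesis Pprime : forall x y,
  in_support P (x * y) -> in_support P x \/ in_support P y.

Lemma in_support_mull a x : in_support P x -> in_support P (a * x).
Proof.
have [_ PM _] := pP; case=> Px PNx; case: (Ptot a) => Pa.
  by split; rewrite -?mulrN; apply/PM.
by split; [rewrite -mulrNN|rewrite -mulNr]; apply/PM.
Qed.

Lemma in_support_sub x y :
  in_support P x -> in_support P y -> in_support P (x - y).
Proof.
have [PD _ _] := pP; case=> Px PNx [Py PNy].
by split; rewrite ?opprB ?[y - x]addrC; apply/PD.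
Qed.

Definition support_pred : A -> bool := fun x => `[< in_support P x >].

Lemma support_idealr_closed : idealr_closed support_pred.
Proof.
have [_ _ PX] := pP; split.
- apply/asboolP; split; rewrite ?oppr0; have := PX 0; by rewrite expr0n.
- by apply/asboolP.
move=> a x y /asboolP Sx /asboolP Sy; apply/asboolP.
rewrite -[y]opprK -[- y]sub0r; apply: in_support_sub.
  exact: in_support_mull.
by apply: in_support_sub => //; rewrite -[0](mul0r y); apply: in_support_mull.
Qed.

HB.instance Definition _ := isIdealr.Build A support_pred support_idealr_closed.

Lemma support_prime_closed : prime_idealr_closed support_pred.
Proof.
move=> x y /asboolP /Pprime[Sx|Sy]; apply/orP; [left|right]; exact/asboolP.
Qed.

HB.instance Definition _ :=
  isPrimeIdealrClosed.Build A support_pred support_prime_closed.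

Definition support_ideal : PrimeIdealr.type A := support_pred.

Local Notation Q := {ideal_quot support_ideal}.

(** The fraction field is taken of an integral domain with inverses of units; here units and
    inverses are chosen classically. *)
Definition residue_unit : pred Q := fun x => `[< exists y, y * x = 1 >].
Definition residue_inv (x : Q) : Q :=
  if pselect (exists y, y * x = 1) is left h then sval (cid h) else x.

Lemma residue_mulVx : {in residue_unit, left_inverse 1 residue_inv *%R}.
Proof.
move=> x /asboolP ux; rewrite /residue_inv.
by case: pselect => // h; case: cid.
Qed.

Lemma residue_unitPl (x y : Q) : y * x = 1 -> residue_unit x.
Proof. by move=> yx; apply/asboolP; exists y. Qed.

Lemma residue_inv_out : {in [predC residue_unit], residue_inv =1 id}.
Proof.
move=> x /negP ux; rewrite /residue_inv; case: pselect => // h.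
by case: ux; apply/asboolP.
Qed.

HB.instance Definition _ := GRing.ComNzRing_hasMulInverse.Build Q
  residue_mulVx residue_unitPl residue_inv_out.

Lemma residue_integral (x y : Q) : x * y = 0 -> (x == 0) || (y == 0).
Proof. exact: Quotient.rquot_IdomainAxiom. Qed.

HB.instance Definition _ := GRing.ComUnitRing_isIntegral.Build Q residue_integral.

Definition to_residue (a : A) : {fraction Q} := tofrac (\pi_Q a).

Lemma to_residue_is_zmod_morphism : zmod_morphism to_residue.
Proof. by move=> x y; rewrite /to_residue !rmorphB. Qed.

Lemma to_residue_is_monoid_morphism : monoid_morphism to_residue.
Proof. by split=> [|x y]; rewrite /to_residue ?rmorph1 // !rmorphM. Qed.

HB.instance Definition _ :=
  GRing.isZmodMorphism.Build A {fraction Q} to_residue to_residue_is_zmod_morphism.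
HB.instance Definition _ :=
  GRing.isMonoidMorphism.Build A {fraction Q} to_residue to_residue_is_monoid_morphism.

Lemma to_residue_eq0 a : to_residue a = 0 <-> in_support P a.
Proof.
rewrite /to_residue; split.
  move/eqP; rewrite tofrac_eq0 => /eqP; rewrite -(rmorph0 \pi_Q) => /eqP.
  by rewrite -Quotient.idealrBE subr0 => /asboolP.
move=> Sa; apply/eqP; rewrite tofrac_eq0 -(rmorph0 \pi_Q) -Quotient.idealrBE subr0.
exact/asboolP.
Qed.

Lemma to_residue_frac (x : {fraction Q}) :
  exists a b, to_residue b != 0 /\ x = to_residue a / to_residue b.
Proof.
have [n [d [dn0 ->]]] : exists n d : Q, d != 0 /\ x = tofrac n / tofrac d.
  elim/quotW: x => x; exists (\n_x), (\d_x); split; first exact: denom_ratioP.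
  apply/(mulIf (x := tofrac \d_x)).
    by rewrite tofrac_eq0 denom_ratioP.
  rewrite divfK ?tofrac_eq0 ?denom_ratioP //.
  unlock tofrac; rewrite -[LHS]FracField.pi_mul.
  apply/eqmodP; rewrite /= FracField.equivfE /FracField.mulf.
  by rewrite !numden_Ratio ?oner_eq0 ?mulr1 ?denom_ratioP // mulrC.
exists (repr n), (repr d); rewrite /to_residue !reprK; split=> //.
by rewrite tofrac_eq0.
Qed.

End ConeQuotient.

(** * The ordering of the residue field *)

Section ConeOrder.
Variables (A : comNzRingType) (P : A -> Prop) (F : fieldType).
Variable theta : {rmorphism A -> F}.
Hypotheses (pP : preordering P) (Ptot : forall x, P x \/ P (- x)).
Hypothesis theta_eq0 : forall a, theta a = 0 <-> in_support P a.
Hypothesis theta_frac : forall x, exists a b, theta b != 0 /\ x = theta a / theta b.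

(** [a / b] and [a * b] differ by a square factor, so they must have the same sign. *)
Definition frac_nonneg (x : F) : bool :=
  `[< exists a b, [/\ theta b != 0, P (a * b) & x = theta a / theta b] >].

(** If [a / b = c / d], then [a * b * d ^+ 2] and [c * d * b ^+ 2] differ by an element of the
    support, so the former is in [P]. Were [- (a * b)] also in [P], it would lie in the support, and
    so would [a * b], since [theta d] is nonzero. *)
Lemma frac_nonnegE a b :
  theta b != 0 -> frac_nonneg (theta a / theta b) <-> P (a * b).
Proof.
move=> b0; split=> [|Pab]; last by apply/asboolP; exists a, b.
have [PD PM PX] := pP.
case/asboolP=> c [d [d0 Pcd e]]; case: (Ptot (a * b)) => // PN.
suff [] : in_support P (a * b) by [].
apply/theta_eq0.
have e1 : theta (a * d - c * b) = 0.
  by rewrite rmorphB !rmorphM; apply/eqP; rewrite subr_eq0 -eqr_div // e.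
have /theta_eq0[S1 S2] : theta ((a * d - c * b) * (b * d)) = 0.
  by rewrite rmorphM e1 mul0r.
have : theta (a * b * d ^+ 2) = 0.
  apply/theta_eq0; split.
    have -> : a * b * d ^+ 2 = (a * d - c * b) * (b * d) + c * d * b ^+ 2 by ring.
    by apply/PD => //; apply/PM.
  by rewrite -mulNr; apply/PM.
rewrite rmorphM rmorphXn => /eqP; rewrite mulf_eq0 expf_eq0 (negPf d0) andbF orbF.
by move/eqP.
Qed.

Lemma frac_nonnegD x y : frac_nonneg x -> frac_nonneg y -> frac_nonneg (x + y).
Proof.
have [PD PM PX] := pP.
have [a [b [b0 ->]]] := theta_frac x; have [c [d [d0 ->]]] := theta_frac y.
move=> /(frac_nonnegE _ b0) Pab /(frac_nonnegE _ d0) Pcd.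
rewrite addf_div // -!rmorphM -rmorphD.
apply/frac_nonnegE; first by rewrite rmorphM mulf_neq0.
have -> : (a * d + c * b) * (b * d) = a * b * d ^+ 2 + c * d * b ^+ 2 by ring.
by apply/PD; apply/PM.
Qed.

Lemma frac_nonnegM x y : frac_nonneg x -> frac_nonneg y -> frac_nonneg (x * y).
Proof.
have [_ PM _] := pP.
have [a [b [b0 ->]]] := theta_frac x; have [c [d [d0 ->]]] := theta_frac y.
move=> /(frac_nonnegE _ b0) Pab /(frac_nonnegE _ d0) Pcd.
rewrite mulf_div -!rmorphM.
apply/frac_nonnegE; first by rewrite rmorphM mulf_neq0.
have -> : (a * c) * (b * d) = a * b * (c * d) by ring.
exact/PM.
Qed.

Lemma frac_nonneg_anti x : frac_nonneg x -> frac_nonneg (- x) -> x = 0.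
Proof.
have [a [b [b0 ->]]] := theta_frac x; rewrite -mulNr -rmorphN.
move=> /(frac_nonnegE _ b0) Pab /(frac_nonnegE _ b0); rewrite mulNr => PNab.
have /eqP : theta (a * b) = 0 by apply/theta_eq0.
by rewrite rmorphM mulf_eq0 (negPf b0) orbF => /eqP->; rewrite mul0r.
Qed.

Lemma frac_nonneg_total x : frac_nonneg x || frac_nonneg (- x).
Proof.
have [a [b [b0 ->]]] := theta_frac x; rewrite -mulNr -rmorphN.
case: (Ptot (a * b)) => Pab; first by apply/orP; left; apply/frac_nonnegE.
by apply/orP; right; apply/frac_nonnegE => //; rewrite mulNr.
Qed.

Definition frac_le x y := frac_nonneg (y - x).
Definition frac_lt x y := (y != x) && frac_le x y.
Definition frac_norm x := if frac_nonneg x then x else - x.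

Lemma cone_order_exists : exists L : realFieldType, exists f : {rmorphism A -> L},
  (forall a, 0 <= f a <-> P a) /\
  (forall x, exists a b, f b != 0 /\ x = f a / f b).
Proof.
have nn0 x : frac_le 0 x = frac_nonneg x by rewrite /frac_le subr0.
have le0 x : frac_le x 0 = frac_nonneg (- x) by rewrite /frac_le sub0r.
have D x y : frac_le 0 x -> frac_le 0 y -> frac_le 0 (x + y).
  by rewrite !nn0; apply: frac_nonnegD.
have M x y : frac_le 0 x -> frac_le 0 y -> frac_le 0 (x * y).
  by rewrite !nn0; apply: frac_nonnegM.
have anti x : frac_le 0 x -> frac_le x 0 -> x = 0.
  by rewrite nn0 le0; apply: frac_nonneg_anti.
have sub x y : frac_le 0 (y - x) = frac_le x y by rewrite nn0.
have tot x : frac_le 0 x || frac_le x 0 by rewrite nn0 le0 frac_nonneg_total.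
have normN x : frac_norm (- x) = frac_norm x.
  rewrite /frac_norm opprK; have := frac_nonneg_total x.
  case: ifP => nx; case: ifP => // px _.
  by rewrite (frac_nonneg_anti px nx) oppr0.
have normp x : frac_le 0 x -> frac_norm x = x.
  by rewrite nn0 /frac_norm => ->.
have ltd x y : frac_lt x y = (y != x) && frac_le x y by [].
pose m := Num.IntegralDomain_isLeReal.Build F D M anti sub tot normN normp ltd.
pose L : realFieldType := HB.pack (F : Type) F m.
pose g : A -> L := theta.
have gB : zmod_morphism g by move=> x y; exact: (rmorphB theta).
have gM : monoid_morphism g.
  by split=> [|x y]; [exact: (rmorph1 theta)|exact: (rmorphM theta)].
pose f : {rmorphism A -> L} := HB.pack g (GRing.isZmodMorphism.Build A L g gB)
  (GRing.isMonoidMorphism.Build A L g gM).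
exists L, f; split; last by move=> x; exact: theta_frac.
move=> a; change (frac_le 0 (theta a) <-> P a); rewrite nn0.
rewrite -[theta a]divr1 -(rmorph1 theta).
by rewrite frac_nonnegE ?mulr1 // rmorph1 oner_neq0.
Qed.

End ConeOrder.

(** The abstract Positivstellensatz. That every element is a ratio of images allows statements over
    [L] to be pulled back to [A] by clearing denominators. *)
Lemma preordering_residue_field (A : comNzRingType) (T : A -> Prop) (s : A) :
  preordering T -> avoids_even_powers s T ->
  exists (L : realFieldType) (f : {rmorphism A -> L}),
    [/\ forall t, T t -> 0 <= f t, f s != 0
      & forall x, exists a b, f b != 0 /\ x = f a / f b].
Proof.
move=> pT sT.
have [P [[pP sP] TP Ptot Ps Pprime]] := prime_cone_exists pT sT.
have P1 : ~ in_support P 1.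
  by move=> /(in_support_mull pP Ptot s); rewrite mulr1.
have [L [f [fP ffrac]]] := cone_order_exists pP Ptot
  (@to_residue_eq0 _ _ pP Ptot P1 Pprime)
  (@to_residue_frac _ _ pP Ptot P1 Pprime).
exists L, f; split=> //; first by move=> t /TP /fP.
apply/eqP => fs0; apply: Ps.
by split; apply/fP; rewrite ?rmorphN fs0 ?oppr0.
Qed.

(** * Real closures *)

Lemma rmorph_poly_horner (K S : comNzRingType) (g : {rmorphism {poly K} -> S})
  (p : {poly K}) : g p = (map_poly (g \o polyC) p).[g 'X].
Proof.
rewrite -{1}[p]coefK poly_def rmorph_sum /map_poly horner_poly.
by apply: eq_bigr => i _; rewrite -mul_polyC rmorphM rmorphXn.
Qed.

Definition monotone_rmorphism (K L : realFieldType) (f : K -> L) :=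
  forall x, 0 <= x -> 0 <= f x.

(** Nonnegative elements of [K] need not be squares. The weights put them into the cone, so that the
    ordered field obtained from it extends the order of [K]. *)
Inductive weighted_sos (K : realFieldType) : {poly K} -> Prop :=
| weighted_sos0 : weighted_sos 0
| weighted_sosD c q u :
    0 <= c -> weighted_sos u -> weighted_sos (c *: q ^+ 2 + u).

Lemma weighted_sos_add (K : realFieldType) (u v : {poly K}) :
  weighted_sos u -> weighted_sos v -> weighted_sos (u + v).
Proof.
move=> + wv; elim=> [|c q w c0 _ IH]; first by rewrite add0r.
by rewrite -addrA; apply: weighted_sosD.
Qed.

Lemma weighted_sos_mul (K : realFieldType) (u v : {poly K}) :
  weighted_sos u -> weighted_sos v -> weighted_sos (u * v).
Proof.
move=> + wv; elim=> [|c q w c0 _ IH]; first by rewrite mul0r; exact: weighted_sos0.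
rewrite mulrDl; apply: weighted_sos_add => //.
elim: wv {IH} => [|d r x d0 _ IH]; first by rewrite mulr0; exact: weighted_sos0.
rewrite mulrDr; have -> : c *: q ^+ 2 * (d *: r ^+ 2) = (c * d) *: (q * r) ^+ 2.
  by rewrite -scalerAl -scalerAr scalerA exprMn.
by apply: weighted_sosD => //; apply: mulr_ge0.
Qed.

Lemma weighted_sos_horner_ge0 (K L : realFieldType) (f : {rmorphism K -> L})
    (u : {poly K}) (y : L) :
  monotone_rmorphism f -> weighted_sos u -> 0 <= (map_poly f u).[y].
Proof.
move=> f0; elim=> [|c q w c0 _ IH]; first by rewrite rmorph0 horner0.
rewrite rmorphD /= hornerD addr_ge0 // map_polyZ hornerZ mulr_ge0 ?f0 //.
by rewrite rmorphXn horner_exp sqr_ge0.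
Qed.

(** Each [q] is replaced by its remainder modulo [p]; the bound says that [v] has degree at most
    twice deg p - 1. *)
Lemma weighted_sos_mod (K : realFieldType) (p u : {poly K}) :
  (1 < size p)%N -> weighted_sos u ->
  exists v r, [/\ weighted_sos v, (size v <= (size p).-2 * 2 + 1)%N & u = v + p * r].
Proof.
move=> p1; elim=> [|c q w c0 _ [v [r [wv sv ->]]]].
  exists 0, 0; split; first exact: weighted_sos0.
    by rewrite size_poly0.
  by rewrite mulr0 addr0.
pose m := q %% p; pose k := q %/ p.
exists (c *: m ^+ 2 + v), (c *: (k * (k * p + 2%:R * m)) + r); split.
- exact: weighted_sosD.
- rewrite (leq_trans (size_polyD _ _)) // geq_max sv andbT.
  rewrite (leq_trans (size_scale_leq _ _)) // (leq_trans (size_poly_exp_leq _ _)) //.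
  rewrite addn1 ltnS leq_mul2r /=.
  have : (size m < size p)%N by rewrite ltn_modp -size_poly_gt0 ltnW.
  by case: (size m) (size p) p1 => [|i] [|[|j]].
have -> : q = k * p + m by exact: divp_eq.
rewrite -!mul_polyC; ring.
Qed.

(* If K[X]/(p) carries no compatible ordering then 1 + v = p q for a weighted sum
   of squares v that may be reduced modulo p, so deg q < deg p. Since p q > 0
   everywhere, q changes sign as well, and a root of q in an ordered extension of
   K contradicts 1 + v > 0. *)
Lemma sign_change_root_extension (K : realFieldType) (p : {poly K}) (a b : K) :
  p.[a] * p.[b] < 0 ->
  exists (L : realFieldType) (f : {rmorphism K -> L}),
    monotone_rmorphism f /\ exists y, root (map_poly f p) y.
Proof.
elim: {p}(size p) {-2}p (leqnn (size p)) => [|n IH] p sp pab.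
  by move: sp pab; rewrite size_poly_leq0 => /eqP->; rewrite horner0 mul0r ltxx.
have p1 : (1 < size p)%N.
  rewrite ltnNge; apply/negP => /size1_polyC e; move: pab.
  by rewrite {}e !hornerC -expr2 ltNge sqr_ge0.
pose T (t : {poly K}) := exists u (r : {poly K}), weighted_sos u /\ t = u + p * r.
have pT : preordering T.
  split.
  - move=> _ _ [u [r [wu ->]]] [v [t [wv ->]]]; exists (u + v), (r + t).
    by split; [exact: weighted_sos_add|ring].
  - move=> _ _ [u [r [wu ->]]] [v [t [wv ->]]].
    exists (u * v), (u * t + v * r + p * r * t).
    by split; [exact: weighted_sos_mul|ring].
  - move=> x; exists (1 *: x ^+ 2 + 0), 0; split.
      by apply: weighted_sosD => //; exact: weighted_sos0.
    by rewrite scale1r mulr0 !addr0.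
have T1 : avoids_even_powers 1 T.
  move=> m [u [r [wu]]]; rewrite expr1n.
  have [v [t [wv sv ->]]] := weighted_sos_mod p1 wu.
  move=> e; pose q := - (t + r).
  have pq : 1 + v = p * q.
    by apply/eqP; rewrite -subr_eq0 -[1]opprK e /q; apply/eqP; ring.
  have ev x : 0 < p.[x] * q.[x].
    rewrite -hornerM -pq hornerD hornerC ltr_pwDl //.
    have := @weighted_sos_horner_ge0 _ _ idfun v x _ wv.
    by rewrite map_poly_id //; apply.
  have q0 : q != 0.
    by apply/eqP => q0; have := ev a; rewrite q0 horner0 mulr0 ltxx.
  have p0 : p != 0 by rewrite -size_poly_gt0 ltnW.
  have sq : (size q <= n)%N.
    have : (size (p * q)%R <= (size p).-2 * 2 + 1)%N.
      rewrite -pq (leq_trans (size_polyD _ _)) // geq_max sv andbT.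
      by rewrite size_poly1 addn1.
    rewrite size_mul //; move: p1 sp; clear; move: (size p) (size q) => i j; lia.
  have qab : q.[a] * q.[b] < 0.
    have : 0 < (p.[a] * p.[b]) * (q.[a] * q.[b]).
      by rewrite mulrACA mulr_gt0.
    by rewrite nmulr_rgt0.
  have [L [f [f0 [y /rootP ry]]]] := IH q sq qab.
  have := weighted_sos_horner_ge0 y f0 wv.
  have -> : v = p * q - 1 by rewrite -pq; ring.
  by rewrite rmorphB rmorphM rmorph1 hornerD hornerM ry mulr0 add0r hornerN hornerC oppr_ge0 ler10.
have [L [g [gT _ _]]] := preordering_residue_field pT T1.
exists L, (g \o polyC); split.
  move=> c c0; apply: gT; exists (c *: 1 ^+ 2 + 0), 0; split.
    by apply: weighted_sosD => //; exact: weighted_sos0.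
  by rewrite expr1n mulr0 !addr0 alg_polyC.
exists (g 'X); apply/rootP; rewrite -rmorph_poly_horner.
(* Both [p] and [- p] lie in [T], which forces [g p = 0]: the image of ['X] is a root. *)
have Tp r : T (p * r) by exists 0, r; rewrite add0r; split=> //; exact: weighted_sos0.
apply/eqP; rewrite eq_le -oppr_ge0 -rmorphN -[p]mulr1 -mulrN.
by rewrite !gT.
Qed.

(** * Compactness and adjunction of all roots *)

Definition cmonom_eval (I : choiceType) (S : comNzRingType) (v : I -> S)
    (m : {cmonom I}) : S :=
  \prod_(k <- finsupp m) v k ^+ m k.

Lemma cmonom_eval_wide (I : choiceType) (S : comNzRingType) (v : I -> S)
    (m : {cmonom I}) (d : {fset I}) :
  (finsupp m `<=` d)%fset -> cmonom_eval v m = \prod_(k <- d) v k ^+ m k.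
Proof.
move=> le; rewrite /cmonom_eval (big_fset_incl _ le) // => k _.
by rewrite -cmE_eq0 => /eqP->; rewrite expr0.
Qed.

Lemma cmonom_eval_mmorphism (I : choiceType) (S : comNzRingType) (v : I -> S) :
  mmorphism (cmonom_eval v).
Proof.
split=> [m1 m2|]; last by rewrite /cmonom_eval mdom1 big_seq_fset0.
rewrite (cmonom_eval_wide v (fsubsetUl (finsupp m1) (finsupp m2))).
rewrite (cmonom_eval_wide v (fsubsetUr (finsupp m1) (finsupp m2))).
rewrite -big_split /= /cmonom_eval mdomD; apply: eq_bigr => k _.
by rewrite cmM exprD.
Qed.

HB.instance Definition _ (I : choiceType) (S : comNzRingType) (v : I -> S) :=
  monalg.isMultiplicative.Build {cmonom I} S (cmonom_eval v)
    (cmonom_eval_mmorphism v).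

Definition malg_eval (I : choiceType) (K S : comNzRingType) (f : {rmorphism K -> S})
    (v : I -> S) : {rmorphism {malg K[{cmonom I}]} -> S} :=
  monalg.mmap f (cmonom_eval v).

Lemma malg_evalX (I : choiceType) (K S : comNzRingType) (f : {rmorphism K -> S})
    (v : I -> S) i : malg_eval f v (mkmalgU (ucm i) 1) = v i.
Proof.
rewrite (_ : malg_eval f v _ = f 1 * cmonom_eval v (ucm i)); last exact: monalg.mmapU.
rewrite rmorph1 mul1r /cmonom_eval mdomU big_seq_fset1.
by rewrite cmUU expr1.
Qed.

Lemma malg_evalC (I : choiceType) (K S : comNzRingType) (f : {rmorphism K -> S})
    (v : I -> S) c : malg_eval f v (malgC c) = f c.
Proof. exact: monalg.mmapC. Qed.

(** The inductive form makes a membership proof a finite tree, which mentions finitely many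
    generators. *)
Inductive generated_cone (A : comNzRingType) (G : A -> Prop) : A -> Prop :=
| generated_cone_in g of G g : generated_cone G g
| generated_cone_sqr x : generated_cone G (x ^+ 2)
| generated_cone_add x y of generated_cone G x & generated_cone G y :
    generated_cone G (x + y)
| generated_cone_mul x y of generated_cone G x & generated_cone G y :
    generated_cone G (x * y).

Lemma generated_cone_finite (A : comNzRingType) (G : A -> Prop) (t : A) :
  generated_cone G t ->
  exists gs : seq A, (forall g, g \in gs -> G g) /\
    forall (L : realFieldType) (f : {rmorphism A -> L}),
      (forall g, g \in gs -> 0 <= f g) -> 0 <= f t.
Proof.
elim=> {t} [g Gg|x|x y _ [gs [Ggs p]] _ [hs [Ghs q]]|x y _ [gs [Ggs p]] _ [hs [Ghs q]]].
- exists [:: g]; split=> [h|L f]; first by rewrite inE => /eqP->.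
  by apply; rewrite inE.
- by exists [::]; split=> // L f _; rewrite rmorphXn sqr_ge0.
- exists (gs ++ hs); split=> [g|L f pos].
    by rewrite mem_cat => /orP[/Ggs|/Ghs].
  by rewrite rmorphD addr_ge0 ?p ?q // => g gin; apply: pos;
     rewrite mem_cat gin ?orbT.
- exists (gs ++ hs); split=> [g|L f pos].
    by rewrite mem_cat => /orP[/Ggs|/Ghs].
  by rewrite rmorphM mulr_ge0 ?p ?q // => g gin; apply: pos;
     rewrite mem_cat gin ?orbT.
Qed.

(** If -1 were in the generated cone, finitely many generators would already put it there, and a
    field making these nonnegative would have -1 >= 0. *)
Lemma realization_compactness (A : comNzRingType) (G : A -> Prop) :
  (forall gs : seq A, (forall g, g \in gs -> G g) ->
    exists (L : realFieldType) (f : {rmorphism A -> L}),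
      forall g, g \in gs -> 0 <= f g) ->
  exists (L : realFieldType) (f : {rmorphism A -> L}), forall g, G g -> 0 <= f g.
Proof.
move=> fin; have pG : preordering (generated_cone G).
  by split; [exact: generated_cone_add|exact: generated_cone_mul
            |exact: generated_cone_sqr].
have aG : avoids_even_powers 1 (generated_cone G).
  move=> m; rewrite expr1n => /generated_cone_finite[gs [Ggs p]].
  have [L [f fgs]] := fin gs Ggs; have := p L f fgs.
  by rewrite rmorphN rmorph1 oppr_ge0 ler10.
have [L [f [fG _ _]]] := preordering_residue_field pG aG.
by exists L, f => g Gg; apply: fG; exact: generated_cone_in.
Qed.

Definition sign_changing (K : realFieldType) (p : {poly K}) :=
  exists a b, p.[a] * p.[b] < 0.

Lemma sign_changing_map (K L : realFieldType) (f : {rmorphism K -> L})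
    (p : {poly K}) :
  monotone_rmorphism f -> sign_changing p -> sign_changing (map_poly f p).
Proof.
move=> f0 [a [b ab]]; exists (f a), (f b); rewrite !horner_map -rmorphM.
rewrite lt_neqAle fmorph_eq0 (lt_eqF ab) /= -oppr_ge0 -rmorphN f0 //.
by rewrite oppr_ge0 ltW.
Qed.

Lemma finite_roots_extension (K : realFieldType) (s : seq {poly K}) :
  exists (L : realFieldType) (f : {rmorphism K -> L}), monotone_rmorphism f /\
    forall p, p \in s -> sign_changing p -> exists y, root (map_poly f p) y.
Proof.
elim: s => [|p s [L [f [f0 fs]]]]; first by exists K, idfun; split=> // x.
have [sp|nsp] := pselect (sign_changing p); last first.
  by exists L, f; split=> // q; rewrite inE => /orP[/eqP->|/fs].
have [a [b ab]] := sign_changing_map f0 sp.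
have [M [g [g0 [y ry]]]] := sign_change_root_extension ab.
exists M, (g \o f); split=> [x x0|q]; first by apply/g0/f0.
rewrite inE => /orP[/eqP->|qs] sq; first by exists y; rewrite map_poly_comp.
have [z rz] := fs q qs sq; exists (g z).
by rewrite map_poly_comp fmorph_root.
Qed.

(** Compactness in a polynomial ring with one variable [X p] per polynomial [p]. The conditions are
    [p] evaluated at [X p] being both >= 0 and <= 0, and nonnegative constants staying nonnegative;
    finitely many of them involve finitely many roots. *)
Lemma roots_extension (K : realFieldType) :
  exists (L : realFieldType) (f : {rmorphism K -> L}), monotone_rmorphism f /\
    forall p, sign_changing p -> exists y, root (map_poly f p) y.
Proof.
pose A := {malg K[{cmonom {poly K}}]}.
pose X (p : {poly K}) : A := mkmalgU (ucm p) 1.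
pose C : {rmorphism K -> A} := @malgC _ K.
pose root_eq p := (map_poly C p).[X p].
pose G (D : {poly K} -> Prop) (g : A) := (exists2 c, 0 <= c & g = C c) \/
  (exists2 p, sign_changing p /\ D p & g = root_eq p \/ g = - root_eq p).
have [|L [f fG]] := @realization_compactness A (G setT).
  move=> gs Ggs.
  have [s {}Ggs] : exists s : seq {poly K}, forall g, g \in gs -> G (fun p => p \in s) g.
    elim: gs Ggs => [|g gs IH] Ggs; first by exists [::].
    have [h|s sG] := IH; first by move=> hgs; apply: Ggs; rewrite inE hgs orbT.
    have mono s' h : {subset s <= s'} -> h \in gs -> G (fun p => p \in s') h.
      move=> sub /sG[|[p [sp ps] e]]; first by left.
      by right; exists p => //; split=> //; exact: sub.
    have [gc|[p [sp _] e]] := Ggs g (mem_head _ _).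
      exists s => h; rewrite inE => /orP[/eqP->|]; first by left.
      exact: mono.
    exists (p :: s) => h; rewrite inE => /orP[/eqP->|].
      by right; exists p => //; rewrite mem_head.
    by apply: mono => q qs; rewrite inE qs orbT.
  have [L [f [f0 fs]]] := finite_roots_extension s.
  (* The value 0 is junk, used only for polynomials without a root in [L]. *)
  pose v p := if pselect (exists y, root (map_poly f p) y) is left h
              then sval (cid h) else 0.
  exists L, (malg_eval f v) => g /Ggs[[c c0 ->]|[p [sp ps] e]].
    by rewrite malg_evalC f0.
  suff e0 : malg_eval f v (root_eq p) = 0.
    by case: e => ->; rewrite ?rmorphN e0 ?oppr0.
  rewrite /root_eq -horner_map /= malg_evalX -map_poly_comp.
  have -> : map_poly (malg_eval f v \o C) p = map_poly f p.
    by apply: eq_map_poly => c /=; rewrite malg_evalC.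
  by rewrite /v; case: pselect => [h|[]]; [case: cid => y /= /rootP|exact: fs].
exists L, (f \o C); split=> [c c0|p sp]; first by apply: fG; left; exists c.
exists (f (X p)); apply/rootP.
have -> : (map_poly (f \o C) p).[f (X p)] = f (root_eq p).
  by rewrite /root_eq -horner_map /= -map_poly_comp.
apply/eqP; rewrite eq_le -oppr_ge0 -rmorphN !fG //; right; exists p; do ?split=> //.
  by left.
by right.
Qed.

(** * The real closure as the limit of a tower *)

Section RealClosure.
Variable K : realFieldType.

Definition root_step (F : realFieldType) : realFieldType :=
  sval (cid (roots_extension F)).

Definition root_up (F : realFieldType) : {rmorphism F -> root_step F} :=
  sval (cid (svalP (cid (roots_extension F)))).

Lemma root_up_monotone (F : realFieldType) : monotone_rmorphism (@root_up F).
Proof. by case: (svalP (cid (svalP (cid (roots_extension F))))). Qed.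

Lemma root_up_root (F : realFieldType) (p : {poly F}) :
  sign_changing p -> exists y, root (map_poly (@root_up F) p) y.
Proof.
by case: (svalP (cid (svalP (cid (roots_extension F))))) => _; apply.
Qed.

Fixpoint tower (n : nat) : realFieldType :=
  if n is m.+1 then root_step (tower m) else K.

Definition up (n : nat) : {rmorphism tower n -> tower n.+1} := @root_up (tower n).

(** An element of some stage. The limit is not formed by identifying names: it is an ordered residue
    field of the polynomial ring over [int] in all names. *)
Definition name := {n : nat & tower n}.

HB.instance Definition _ := gen_eqMixin name.
HB.instance Definition _ := gen_choiceMixin name.

Definition name_at (n : nat) (i : name) : option (tower n) :=
  if tag i =P n is ReflectT e
  then Some (eq_rect _ (fun m => tower m : Type) (tagged i) _ e) else None.

(* Meaningful when [tag i <= N]; a name of a later stage is sent to the junk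
   value 0. *)
Fixpoint name_eval (N : nat) (i : name) : tower N :=
  if name_at N i is Some x then x else
  match N return tower N with
  | 0%N => 0
  | M.+1 => up M (name_eval M i)
  end.

Lemma name_eval_self n (c : tower n) : name_eval n (Tagged tower c) = c.
Proof.
have e : name_at n (Tagged tower c) = Some c.
  by rewrite /name_at; case: eqP => // e; rewrite (eq_axiomK e).
by case: n c e => [|n] c e /=; rewrite e.
Qed.

Lemma name_evalS N (i : name) :
  (tag i <= N)%N -> name_eval N.+1 i = up N (name_eval N i).
Proof.
by move=> le; rewrite /= /name_at; case: eqP => // e; rewrite e ltnn in le.
Qed.

Definition name_ring := {malg int[{cmonom name}]}.
Definition name_var (i : name) : name_ring := mkmalgU (ucm i) 1.
Definition level_eval (N : nat) : {rmorphism name_ring -> tower N} :=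
  malg_eval intr (name_eval N).

(** Below the stages of the names in [a], evaluation meets the junk value 0, so compatibility with
    [up] can only be asked from some stage on. *)
Definition stable_from (a : name_ring) (n : nat) :=
  forall N, (n <= N)%N -> level_eval N.+1 a = up N (level_eval N a).

Lemma stable_from_le a n m : (n <= m)%N -> stable_from a n -> stable_from a m.
Proof. by move=> nm sa N mN; apply: sa; exact: leq_trans mN. Qed.

Lemma stable_from_var i n : (tag i <= n)%N -> stable_from (name_var i) n.
Proof.
by move=> le N nN; rewrite !malg_evalX name_evalS //; exact: leq_trans nN.
Qed.

Lemma stable_from_sub a b n :
  stable_from a n -> stable_from b n -> stable_from (a - b) n.
Proof. by move=> sa sb N nN; rewrite !rmorphB sa // sb. Qed.

Lemma stable_from_mul a b n :
  stable_from a n -> stable_from b n -> stable_from (a * b) n.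
Proof. by move=> sa sb N nN; rewrite !rmorphM sa // sb. Qed.

(** Only finitely many names occur in [a]; any bound on their stages works. *)
Lemma stable_from_exists a : exists n, stable_from a n.
Proof.
have bound (T : eqType) (s : seq T) (P : T -> nat -> Prop) :
    (forall x n m, (n <= m)%N -> P x n -> P x m) -> (forall x, exists n, P x n) ->
    exists n, forall x, x \in s -> P x n.
  move=> mono ex; elim: s => [|x s [n IH]]; first by exists 0%N.
  have [m Pm] := ex x; exists (maxn m n) => y; rewrite inE => /orP[/eqP->|ys].
    by apply: mono Pm; rewrite leq_maxl.
  by apply: mono (IH y ys); rewrite leq_maxr.
have [n nP] := bound _ (monalg.msupp a)
  (fun m n => forall k, k \in finsupp m -> (tag k <= n)%N)
  (fun m n n' le h k km => leq_trans (h k km) le)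
  (fun m => bound _ (finsupp m) (fun k n => (tag k <= n)%N)
     (fun k n n' le h => leq_trans h le) (fun k => ex_intro _ (tag k) (leqnn _))).
exists n => N nN.
rewrite -[LHS]/(monalg.mmap _ _ a) -[level_eval N a]/(monalg.mmap _ _ a).
rewrite /monalg.mmap rmorph_sum; apply: eq_big_seq => m ma.
rewrite rmorphM rmorph_int; congr (_ * _).
rewrite /cmonom_eval rmorph_prod; apply: eq_big_seq => k km.
by rewrite rmorphXn name_evalS // (leq_trans (nP m ma k km)).
Qed.

(** The order of the direct limit: as every element is stable from some stage, [a] or [- a] always
    satisfies this. *)
Definition eventually_ge0 (a : name_ring) :=
  exists n, forall N, (n <= N)%N -> 0 <= level_eval N a.

Lemma eventually_ge0_preordering : preordering eventually_ge0.
Proof.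
split=> [a b [n na] [m mb]|a b [n na] [m mb]|a].
- exists (maxn n m) => N; rewrite geq_max => /andP[nN mN].
  by rewrite rmorphD addr_ge0 ?na ?mb.
- exists (maxn n m) => N; rewrite geq_max => /andP[nN mN].
  by rewrite rmorphM mulr_ge0 ?na ?mb.
- by exists 0%N => N _; rewrite rmorphXn sqr_ge0.
Qed.

Lemma eventually_ge0_avoids : avoids_even_powers 1 eventually_ge0.
Proof.
move=> m [n /(_ n (leqnn n))].
by rewrite expr1n rmorphN rmorph1 oppr_ge0 ler10.
Qed.

Lemma stable_eval_ge0 a n :
  stable_from a n -> 0 <= level_eval n a -> eventually_ge0 a.
Proof.
move=> sa a0; exists n => N /subnK <-.
elim: (N - n)%N => [|k IH]; first by rewrite add0n.
by rewrite addSn sa ?leq_addl //; apply: root_up_monotone.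
Qed.

(** A root [y] outside [[a, b]] is divided out: ['X - y%:P] has constant sign on [[a, b]], so the
    quotient, of smaller degree, still has values of opposite sign at the ends, up to replacing it
    by its opposite when [y] lies above [b]. *)
Lemma sign_changing_roots_closed (L : realFieldType) :
  (forall p : {poly L}, sign_changing p -> exists y, root p y) ->
  Num.real_closed_axiom L.
Proof.
move=> rts p; elim: {p}(size p) {-2}p (leqnn (size p)) => [|n IH] p sp a b ab.
  move: sp; rewrite size_poly_leq0 => /eqP-> _.
  by exists a; rewrite ?lexx // root0.
case/andP; rewrite le_eqVlt => /orP[/eqP pa0 _|pa].
  by exists a; rewrite ?lexx //; apply/rootP.
rewrite le_eqVlt => /orP[/eqP pb0|pb].
  by exists b; rewrite ?lexx ?andbT //; apply/rootP.
have [|y ry] := rts p; first by exists a, b; rewrite nmulr_rlt0.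
have [yab|nyab] := boolP (a <= y <= b); first by exists y.
have [q e] := factor_theorem p y ry; rewrite {}e in sp pa pb *.
have {sp}sq : (size q <= n)%N.
  have [->|q0] := eqVneq q 0; first by rewrite size_poly0.
  by move: sp; rewrite size_mul ?polyXsubC_eq0 // size_XsubC addn2.
rewrite !(hornerM, hornerXsubC) in pa pb.
have [x xab rx] : exists2 x, a <= x <= b & root q x.
  move: nyab; rewrite negb_and -!ltNge => /orP[ya|by'].
    have qa : q.[a] <= 0 by move: pa; rewrite pmulr_llt0 ?subr_gt0 // => /ltW.
    have qb : 0 <= q.[b].
      by move: pb; rewrite pmulr_lgt0 ?subr_gt0 ?(lt_le_trans ya) // => /ltW.
    by apply: (IH q sq a b ab); rewrite qa qb.
  have qa : 0 <= q.[a].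
    by move: pa; rewrite nmulr_llt0 ?subr_lt0 ?(le_lt_trans ab) // => /ltW.
  have qb : q.[b] <= 0 by move: pb; rewrite nmulr_lgt0 ?subr_lt0 // => /ltW.
  have [] := IH (- q) _ a b ab; rewrite ?size_polyN //.
    by rewrite !hornerN oppr_le0 oppr_ge0 qa qb.
  by move=> x xab; rewrite rootN; exists x.
by exists x => //; rewrite rootM rx.
Qed.

(** An element of the residue field is a ratio of images, so it comes from a stage where numerator
    and denominator are both stable. A polynomial has finitely many coefficients, so it and a sign
    change of it come from one stage, and the next stage holds a root. *)
Lemma real_closure_exists :
  exists (L : rcfType) (f : {rmorphism K -> L}), monotone_rmorphism f.
Proof.
have [L [f [fpos _ ffrac]]] :=
  preordering_residue_field eventually_ge0_preordering eventually_ge0_avoids.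
have f0 a n : stable_from a n -> level_eval n a = 0 -> f a = 0.
  move=> sa a0; apply/eqP; rewrite eq_le -oppr_ge0 -rmorphN.
  apply/andP; split; apply: fpos; apply: (@stable_eval_ge0 _ n) => //.
  - by move=> N nN; rewrite !rmorphN sa.
  - by rewrite rmorphN a0 oppr0.
  - by rewrite a0.
have feq a b n : stable_from a n -> stable_from b n ->
    level_eval n a = level_eval n b -> f a = f b.
  move=> sa sb ab; apply/eqP; rewrite -subr_eq0.
  have -> : f a - f b = f (a - b) by rewrite rmorphB.
  apply/eqP/(f0 _ n); first exact: stable_from_sub.
  by rewrite rmorphB ab subrr.
(* [Z n c] is the variable named by [c]. The map [Z n] is not a morphism, but [f] composed with it
   is: the defects are stable and vanish at stage [n], hence are killed by [f]. *)
have [Z [Zev sZ]] : exists Z : forall n, tower n -> name_ring,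
    (forall n c, level_eval n (Z n c) = c) /\ (forall n c, stable_from (Z n c) n).
  exists (fun n c => name_var (Tagged tower c)); split=> n c.
    by rewrite malg_evalX name_eval_self.
  exact: stable_from_var.
have lim_morph n : exists g : {rmorphism tower n -> L}, forall c, g c = f (Z n c).
  pose g (c : tower n) : L := f (Z n c).
  have gB : zmod_morphism g.
    move=> c d; have -> : g c - g d = f (Z n c - Z n d) by rewrite rmorphB.
    apply: (@feq _ _ n) => //; first exact: stable_from_sub.
    by rewrite (rmorphB (level_eval n)) !Zev.
  have gM : monoid_morphism g.
    split=> [|c d].
      rewrite -(rmorph1 f); apply: (@feq _ _ n) => //.
        by move=> N _; rewrite !rmorph1.
      by rewrite (rmorph1 (level_eval n)) Zev.
    have -> : g c * g d = f (Z n c * Z n d) by rewrite rmorphM.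
    apply: (@feq _ _ n) => //; first exact: stable_from_mul.
    by rewrite (rmorphM (level_eval n)) !Zev.
  pose h : {rmorphism tower n -> L} := HB.pack g
    (GRing.isZmodMorphism.Build _ _ g gB) (GRing.isMonoidMorphism.Build _ _ g gM).
  by exists h.
have [lm lmE] : exists lm : forall n, {rmorphism tower n -> L}, forall n c, lm n c = f (Z n c).
  by exists (fun n => sval (cid (lim_morph n))) => n; exact: svalP (cid (lim_morph n)).
have lm_up n c : lm n.+1 (up n c) = lm n c.
  rewrite !lmE; apply: (@feq _ _ n.+1) => //.
    exact: stable_from_le (sZ _ _).
  by rewrite Zev sZ // Zev.
have lm_mono n : monotone_rmorphism (lm n).
  move=> c c0; rewrite lmE; apply: fpos.
  by apply: (@stable_eval_ge0 _ n) => //; rewrite Zev.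
have im_mono n m x : (n <= m)%N -> (exists c, x = lm n c) -> exists c, x = lm m c.
  move=> /subnK <-; elim: (m - n)%N => [|k IH]; first by rewrite add0n.
  by case/IH => c ->; exists (up _ c); rewrite lm_up.
have im_ex x : exists n c, x = lm n c.
  have [a [b [b0 ->]]] := ffrac x.
  have [n sn] := stable_from_exists a; have [m sm] := stable_from_exists b.
  pose N := maxn n m.
  have sa : stable_from a N by apply: stable_from_le sn; rewrite leq_maxl.
  have sb : stable_from b N by apply: stable_from_le sm; rewrite leq_maxr.
  have eb0 : level_eval N b != 0 by apply: contra_neq b0; exact: f0.
  exists N, (level_eval N a / level_eval N b); rewrite lmE.
  apply: (mulIf b0); rewrite divfK //.
  have -> : f (Z N (level_eval N a / level_eval N b)) * f b =
    f (Z N (level_eval N a / level_eval N b) * b) by rewrite rmorphM.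
  apply: (@feq _ _ N) => //; first exact: stable_from_mul.
  by rewrite (rmorphM (level_eval N)) Zev divfK.
have im_poly_mono n m (q : {poly tower n}) : (n <= m)%N ->
    exists q', map_poly (lm n) q = map_poly (lm m) q'.
  move=> nm.
  have /choice[h hE] : forall y : tower n, exists z : tower m, lm n y = lm m z.
    by move=> y; apply: (im_mono n) => //; exists y.
  exists (\poly_(i < size q) h q`_i); apply/polyP => i.
  rewrite !coef_map coef_poly /=.
  case: ltnP => [_|le]; first exact: hE.
  by rewrite nth_default // !rmorph0.
have im_poly (p : {poly L}) : exists n q, p = map_poly (lm n) q.
  elim/poly_ind: p => [|p x [n [q ->]]]; first by exists 0%N, 0; rewrite rmorph0.
  have [m [c ->]] := im_ex x; pose N := maxn n m.
  have [c' ->] : exists c', lm m c = lm N c'.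
    by apply: (im_mono m); [rewrite leq_maxr|exists c].
  have [q' ->] := im_poly_mono n N q (leq_maxl _ _).
  exists N, (q' * 'X + c'%:P).
  by rewrite rmorphD rmorphM /= map_polyX map_polyC.
have rts (p : {poly L}) : sign_changing p -> exists y, root p y.
  have [n [q ->]] := im_poly p; case=> x [y].
  have [m [c ->]] := im_ex x; have [k [d ->]] := im_ex y.
  pose N := maxn n (maxn m k).
  have [q' ->] := im_poly_mono n N q (leq_maxl _ _).
  have [c' ->] : exists c', lm m c = lm N c'.
    by apply: (im_mono m); [rewrite leq_max leq_maxl orbT|exists c].
  have [d' ->] : exists d', lm k d = lm N d'.
    by apply: (im_mono k); [rewrite leq_max leq_maxr orbT|exists d].
  rewrite !horner_map -rmorphM => neg.
  have [|y' ry] := @root_up_root _ q'.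
    exists c', d'; rewrite ltNge; apply/negP => /lm_mono.
    by rewrite leNgt neg.
  exists (lm N.+1 y'); rewrite (_ : map_poly (lm N) q' = map_poly (lm N.+1) (map_poly (up N) q')).
    by rewrite fmorph_root.
  by rewrite -map_poly_comp; apply: eq_map_poly => z /=; rewrite lm_up.
pose M : rcfType := HB.pack (L : Type) L
  (Num.RealField_isClosed.Build L (sign_changing_roots_closed rts)).
pose g : K -> M := lm 0%N.
have gB : zmod_morphism g by move=> x y; exact: (rmorphB (lm 0%N)).
have gM : monoid_morphism g.
  by split=> [|x y]; [exact: (rmorph1 (lm 0%N))|exact: (rmorphM (lm 0%N))].
pose h : {rmorphism K -> M} := HB.pack g
  (GRing.isZmodMorphism.Build K M g gB) (GRing.isMonoidMorphism.Build K M g gM).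
by exists M, h; exact (lm_mono 0%N).
Qed.

End RealClosure.

(** * The transfer principle *)

Lemma size_map_poly_leq (R S : nzRingType) (f : {rmorphism R -> S}) (p : {poly R}) :
  (size (map_poly f p) <= size p)%N.
Proof. exact: size_poly. Qed.

(* [phi] is fixed and is allowed to steer the computation (e.g. to truncate a
   polynomial whose leading coefficient it kills); only the morphisms [psi] that
   agree in sign with [phi] on a finite set vary. *)
Section SignDetermination.
Variables (A : idomainType) (L : rcfType) (phi : {rmorphism A -> L}).

Definition sign_agree (S : rcfType) (psi : {rmorphism A -> S}) (E : seq A) :=
  forall e, e \in E -> sgz (psi e) = sgz (phi e).

(** Plays the part of a quantifier-free condition on [psi] satisfied by [phi]: the signs of finitely
    many elements decide it. *)
Definition sign_determined (Q : forall S : rcfType, {rmorphism A -> S} -> Prop) :=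
  exists E : seq A, forall (S : rcfType) (psi : {rmorphism A -> S}),
    sign_agree psi E -> Q S psi.

Lemma sign_determined_and (Q1 Q2 : forall S : rcfType, {rmorphism A -> S} -> Prop) :
  sign_determined Q1 -> sign_determined Q2 ->
  sign_determined (fun S psi => Q1 S psi /\ Q2 S psi).
Proof.
move=> [E1 h1] [E2 h2]; exists (E1 ++ E2) => S psi agr.
by split; [apply: h1|apply: h2] => e eE; apply: agr; rewrite mem_cat eE ?orbT.
Qed.

Lemma sign_determined_impl (Q1 Q2 : forall S : rcfType, {rmorphism A -> S} -> Prop) :
  (forall S psi, Q1 S psi -> Q2 S psi) -> sign_determined Q1 -> sign_determined Q2.
Proof. by move=> h [E hE]; exists E => S psi /hE/h. Qed.

Lemma sign_determined_all (T : eqType) (s : seq T)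
    (Q : T -> forall S : rcfType, {rmorphism A -> S} -> Prop) :
  (forall x, sign_determined (Q x)) ->
  sign_determined (fun S psi => forall x, x \in s -> Q x S psi).
Proof.
move=> h; elim: s => [|x s IH]; first by exists [::].
apply: sign_determined_impl (sign_determined_and (h x) IH) => S psi [hx hs] y.
by rewrite inE => /orP[/eqP->|/hs].
Qed.

Lemma sign_determined_true (Q : forall S : rcfType, {rmorphism A -> S} -> Prop) :
  (forall S psi, Q S psi) -> sign_determined Q.
Proof. by move=> h; exists [::] => S psi _. Qed.

(** Leading coefficients killed by [phi] are dropped until one survives. Pseudo-division by the
    result then specializes well, since its leading coefficient is nonzero under every agreeing
    [psi]. *)
Lemma truncation_determined (P : {poly A}) : exists P' : {poly A},
  [/\ map_poly phi P = map_poly phi P', size (map_poly phi P') = size P'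
    & sign_determined (fun S psi =>
        [/\ map_poly psi P = map_poly psi P', size (map_poly psi P') = size P'
          & sgz (psi (lead_coef P')) = sgz (phi (lead_coef P'))])].
Proof.
elim: {P}(size P) {-2}P (leqnn (size P)) => [|n IH] P sP.
  move: sP; rewrite size_poly_leq0 => /eqP->; exists 0.
  split; rewrite ?rmorph0 ?size_poly0 //; apply: sign_determined_true => S psi.
  by rewrite !rmorph0 lead_coef0 !rmorph0 size_poly0 !sgz0.
have [lc0|lcn0] := eqVneq (phi (lead_coef P)) 0; last first.
  exists P; split=> //; first by rewrite size_map_poly_id0.
  exists [:: lead_coef P] => S psi /(_ _ (mem_head _ _)) e; split=> //.
  by rewrite size_map_poly_id0 // -sgz_eq0 e sgz_eq0.
have [P0|Pn0] := eqVneq P 0.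
  by apply: IH; rewrite P0 size_poly0.
pose Q := take_poly (size P).-1 P.
have PQ : P = Q + lead_coef P *: 'X^((size P).-1).
  apply/polyP => i; rewrite coefD coef_take_poly coefZ coefXn.
  have [lt|] := ltnP; first by rewrite ltn_eqF // mulr0 addr0.
  rewrite leq_eqVlt => /orP[/eqP<-|gt].
    by rewrite eqxx mulr1 add0r.
  rewrite gtn_eqF // mulr0 addr0 nth_default //.
  by move: gt; rewrite prednK // size_poly_gt0.
have sQ : (size Q <= n)%N.
  rewrite (leq_trans (size_take_poly _ _)) //.
  by move: sP; case: (size P).
have [P' [e1 e2 det]] := IH Q sQ; exists P'; split=> //.
  by rewrite PQ rmorphD /= map_polyZ /= lc0 scale0r addr0.
have lcdet : sign_determined (fun S psi => psi (lead_coef P) = 0).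
  exists [:: lead_coef P] => S psi /(_ _ (mem_head _ _)).
  by rewrite lc0 sgz0 => /eqP; rewrite sgz_eq0 => /eqP.
apply: sign_determined_impl (sign_determined_and det lcdet) => S psi [[f1 f2 f3] f4].
by split=> //; rewrite PQ rmorphD /= map_polyZ /= f4 scale0r addr0.
Qed.

Lemma lead_coef_determined (P : {poly A}) : sign_determined (fun S psi =>
  size (map_poly psi P) = size (map_poly phi P) /\
  sgz (lead_coef (map_poly psi P)) = sgz (lead_coef (map_poly phi P))).
Proof.
have [P' [e1 e2 det]] := truncation_determined P.
apply: sign_determined_impl det => S psi [f1 f2 f3].
rewrite e1 f1 e2 f2; split=> //.
by rewrite !lead_coefE f2 e2 !coef_map -lead_coefE f3.
Qed.

(** Through the Cauchy index, whose jumps do not see a positive factor. *)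
Lemma changes_mods_scale (S : rcfType) (p q : {poly S}) (c : S) :
  0 < c -> changes_mods p (c *: q) = changes_mods p q.
Proof.
move=> c0; rewrite !changes_mods_cindex; apply: eq_bigr => x _.
by rewrite jump_mulCp gtr0_sgz // mul1r.
Qed.

Lemma next_mod_modp (S : rcfType) (p q : {poly S}) : q != 0 ->
  exists2 c : S, 0 < c & next_mod p q = - c *: (p %% q).
Proof.
move=> q0; set l := lead_coef q ^+ Pdiv.Ring.rscalp p q.
have l0 : l != 0 by rewrite expf_neq0 ?lead_coef_eq0.
(* [%%] divides the pseudo-remainder by [l] and [next_mod] multiplies it by [- l]; the ratio is
   minus a square. *)
exists (l * l); first by rewrite -expr2 exprn_even_gt0.
by rewrite modpE scalerA mulNr mulfK.
Qed.

Lemma crossR_eq (S : rcfType) (p q : {poly S}) (r : {poly L}) :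
  size (p * q) = size r -> sgz (lead_coef (p * q)) = sgz (lead_coef r) ->
  crossR (p * q) = crossR r.
Proof.
move=> es el; rewrite /crossR /variation /sgp_minfty /sgp_pinfty.
by rewrite -![_ < _]sgz_cp0 !(sgz_sgr, sgzM) es el !sgzX !sgzN !sgz1.
Qed.

(** Euclid's algorithm is run in [A], on the truncations dictated by [phi]. Each step contributes a
    [crossR] term that depends only on sizes and leading signs. *)
Lemma changes_mods_determined (P Q : {poly A}) : sign_determined (fun S psi =>
  changes_mods (map_poly psi P) (map_poly psi Q) =
  changes_mods (map_poly phi P) (map_poly phi Q)).
Proof.
elim: {Q}(size (map_poly phi Q)) {-2}Q P (leqnn (size (map_poly phi Q))) => [|n IH] Q P sQ.
  move: sQ; rewrite size_poly_leq0 => /eqP Q0.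
  apply: sign_determined_impl (lead_coef_determined Q) => S psi [].
  rewrite Q0 size_poly0 => /eqP; rewrite size_poly_eq0 => /eqP-> _.
  by rewrite !changes_modsp0.
have [Q0|Qn0] := eqVneq (map_poly phi Q) 0; first by apply: IH; rewrite Q0 size_poly0.
have [Q' [e1 e2 det]] := truncation_determined Q.
pose k := Pdiv.Ring.rscalp P Q'.
(* The pseudo-remainder is the true remainder times the [k]-th power of the leading coefficient. The
   second such factor makes this a square, so [T] maps to a positive multiple of [next_mod] whatever
   the sign of that coefficient. *)
pose T := - (lead_coef Q') ^+ k *: Pdiv.Ring.rmodp P Q'.
have modT (S : rcfType) (psi : {rmorphism A -> S}) :
    map_poly psi Q = map_poly psi Q' -> size (map_poly psi Q') = size Q' ->
    map_poly psi Q' != 0 ->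
    exists2 c, 0 < c & next_mod (map_poly psi P) (map_poly psi Q) =
                       c *: map_poly psi T.
  move=> f1 f2 f3; have [|c c0 ->] := @next_mod_modp _ (map_poly psi P) (map_poly psi Q).
    by rewrite f1.
  set l := psi (lead_coef Q').
  have l0 : l != 0.
    have : lead_coef (map_poly psi Q') != 0 by rewrite lead_coef_eq0.
    by rewrite lead_coefE f2 coef_map -lead_coefE.
  have := congr1 (map_poly psi) (Pdiv.ComRing.rdivp_eq Q' P).
  rewrite rmorphD rmorphM /= map_polyZ rmorphXn /= -/l -/k => ediv.
  have -> : map_poly psi P %% map_poly psi Q =
      (l ^+ k)^-1 *: map_poly psi (Pdiv.Ring.rmodp P Q').
    rewrite f1; symmetry; apply: (modpP (q := (l ^+ k)^-1 *: map_poly psi (Pdiv.Ring.rdivp P Q'))).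
      by rewrite -scalerAl -scalerDr -ediv scalerA mulVf ?expf_neq0 // scale1r.
    rewrite f2 (leq_ltn_trans (size_scale_leq _ _)) //.
    rewrite (leq_ltn_trans (size_map_poly_leq _ _)) // Pdiv.Ring.ltn_rmodp.
    by apply: contra_neq f3 => ->; rewrite rmorph0.
  exists (c * (l ^+ k * l ^+ k)^-1).
    by rewrite mulr_gt0 // invr_gt0 -expr2 exprn_even_gt0 //= expf_neq0.
  rewrite /T map_polyZ /= rmorphN rmorphXn /= -/l !scalerA; congr (_ *: _).
  by have := expf_neq0 k l0; move: (l ^+ k) => u u0; field.
have [c0 cc0 ecphi] := modT L phi e1 e2 (etrans (congr1 (fun x => x != 0) (esym e1)) Qn0).
have sT : (size (map_poly phi T) <= n)%N.
  rewrite -ltnS (leq_trans _ sQ) // e1 e2.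
  rewrite (leq_ltn_trans (size_map_poly_leq _ _)) //.
  rewrite (leq_ltn_trans (size_scale_leq _ _)) // Pdiv.Ring.ltn_rmodp.
  by rewrite -size_poly_gt0 -e2 -e1 size_poly_gt0.
have := sign_determined_and (IH T Q sT) (sign_determined_and det
  (sign_determined_and (lead_coef_determined P) (lead_coef_determined Q))).
apply: sign_determined_impl => S psi [f1 [[f2 f3 f4] [[f5 f6] [f7 f8]]]].
have Qn0' : map_poly psi Q != 0 by rewrite -size_poly_gt0 f7 size_poly_gt0.
have [c cc ecpsi] := modT S psi f2 f3 (etrans (congr1 (fun x => x != 0) (esym f2)) Qn0').
rewrite changes_mods_rec [RHS]changes_mods_rec ecphi ?ecpsi -?e1 -?f2 //.
rewrite !changes_mods_scale // f1; congr (_ + _).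
have [P0|Pn0] := eqVneq (map_poly phi P) 0.
  move: f5; rewrite P0 size_poly0 => /eqP; rewrite size_poly_eq0 => /eqP->.
  by rewrite !mul0r !crossR0.
have Pn0' : map_poly psi P != 0 by rewrite -size_poly_gt0 f5 size_poly_gt0.
by apply: crossR_eq; rewrite ?size_mul ?lead_coefM ?sgzM ?f5 ?f6 ?f7 ?f8.
Qed.

End SignDetermination.

(* A weighted count of the points of [z] at which the signs of all [c.1] are
   prescribed by [c.2]; the factor [2 ^ size l] keeps it an integer combination
   of the Tarski queries [taq z]. *)
Definition sign_count (S : rcfType) (z : seq S) (l : seq ({poly S} * int))
    (r : {poly S}) : int :=
  \sum_(x <- z) (sgz r.[x] * \prod_(c <- l) (2 * (sgz c.1.[x] == c.2)%:Z)).

Lemma sign_count_nil (S : rcfType) (z : seq S) (r : {poly S}) :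
  sign_count z [::] r = taq z r.
Proof. by rewrite /taq; apply: eq_bigr => x _; rewrite big_nil mulr1. Qed.

(** With e the sign of [q] at a point, twice the indicator of e = s is e^2 + s e when s is 1 or -1,
    and 2 - 2 e^2 when s = 0. *)
Lemma sign_count_cons (S : rcfType) (z : seq S) (q r : {poly S}) (s : int)
    (l : seq ({poly S} * int)) : s \in [:: 1; -1; 0] ->
  sign_count z ((q, s) :: l) r =
    (if s == 0 then 2 * sign_count z l r - 2 * sign_count z l (q ^+ 2 * r)
     else sign_count z l (q ^+ 2 * r) + s * sign_count z l (q * r)).
Proof.
move=> sE; have key x : 2 * (sgz q.[x] == s)%:Z = if s == 0
    then 2 - 2 * sgz q.[x] ^+ 2 else sgz q.[x] ^+ 2 + s * sgz q.[x].
  move: sE; rewrite !inE => /or3P[] /eqP->;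
  by case: sgzP => _; rewrite ?eqxx.
rewrite /sign_count; case: ifP => s0.
  rewrite !mulr_sumr -sumrB; apply: eq_bigr => x _.
  by rewrite big_cons /= key s0 hornerM ?horner_exp !sgzM ?sgzX; ring.
rewrite mulr_sumr -big_split /=; apply: eq_bigr => x _.
by rewrite big_cons /= key s0 !hornerM ?horner_exp !sgzM ?sgzX; ring.
Qed.

Lemma sign_count_gt0 (S : rcfType) (z : seq S) (l : seq ({poly S} * int)) :
  0 < sign_count z l 1 <->
  exists2 x, x \in z & forall c, c \in l -> sgz c.1.[x] = c.2.
Proof.
rewrite /sign_count; split=> [|[x xz xl]].
  case: (pselect (exists2 x, x \in z & forall c, c \in l -> sgz c.1.[x] = c.2)) => //.
  move=> nex; rewrite big_seq big1 ?ltxx // => x xz.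
  have [c cl /eqP/negPf e] : exists2 c, c \in l & sgz c.1.[x] <> c.2.
    apply: contrapT => h; apply: nex; exists x => // c cl.
    by apply: contrapT => h'; apply: h; exists c.
  by rewrite (big_rem c cl) /= e mulr0 mul0r mulr0.
have pos y : 0 <= sgz (1 : {poly S}).[y] * \prod_(c <- l) (2 * (sgz c.1.[y] == c.2)%:Z) :> int.
  by rewrite hornerC sgz1 mul1r prodr_ge0.
rewrite (big_rem x xz) /= ltr_pwDl ?sumr_ge0 //.
rewrite hornerC sgz1 mul1r big_seq prodr_gt0 // => c cl.
by rewrite xl // eqxx.
Qed.

(** * Realizing sign conditions in one variable *)

Section OneVariable.
Variables (A : idomainType) (L : rcfType) (phi : {rmorphism A -> L}).

Lemma sign_count_determined (P R : {poly A}) (l : seq ({poly A} * int)) :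
  all (fun c => c.2 \in [:: 1; -1; 0]) l ->
  sign_determined phi (fun S psi =>
    sign_count (rootsR (map_poly psi P)) [seq (map_poly psi c.1, c.2) | c <- l]
      (map_poly psi R) =
    sign_count (rootsR (map_poly phi P)) [seq (map_poly phi c.1, c.2) | c <- l]
      (map_poly phi R)).
Proof.
elim: l R => [|[q s] l IH] R /=.
  move=> _; have := changes_mods_determined phi P (P^`() * R).
  apply: sign_determined_impl => S psi.
  by rewrite !sign_count_nil !taq_taqR /taqR !rmorphM /= !deriv_map.
case/andP=> sE lE; have d1 := IH R lE; have d2 := IH (q * R) lE.
have d3 := IH (q ^+ 2 * R) lE.
apply: sign_determined_impl (sign_determined_and d1 (sign_determined_and d2 d3)).
move=> S psi [e1 [e2 e3]]; rewrite !sign_count_cons //.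
by rewrite !(rmorphM, rmorphXn) /= in e2 e3 *; rewrite e1 e2 e3.
Qed.

Lemma sgz_values (S : rcfType) (x : S) : sgz x \in [:: 1; -1; 0].
Proof. by case: sgzP. Qed.

Lemma root_signs_determined (F : seq {poly A}) (P : {poly A}) (y : L) :
  map_poly phi P != 0 -> root (map_poly phi P) y ->
  sign_determined phi (fun S psi => exists b : S,
    forall Q, Q \in F -> sgz (map_poly psi Q).[b] = sgz (map_poly phi Q).[y]).
Proof.
move=> P0 ry; pose l := [seq (Q, sgz (map_poly phi Q).[y]) | Q <- F].
have lE : all (fun c => c.2 \in [:: 1; -1; 0]) l.
  by apply/allP => c /mapP[Q _ ->]; exact: sgz_values.
apply: sign_determined_impl (sign_count_determined P 1 lE) => S psi.
rewrite !rmorph1 => e.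
have : 0 < sign_count (rootsR (map_poly phi P))
    [seq (map_poly phi c.1, c.2) | c <- l] 1.
  apply/sign_count_gt0; exists y; first by rewrite -(roots_on_rootsR P0) ?inE.
  by move=> c /mapP[c' /mapP[Q QF ->] ->].
rewrite -e => /sign_count_gt0[b _ h]; exists b => Q QF.
apply: (h (map_poly psi Q, sgz (map_poly phi Q).[y])).
apply/mapP; exists (Q, sgz (map_poly phi Q).[y]) => //.
by apply/mapP; exists Q.
Qed.

(** If [y] is a root of a nonzero polynomial of the list, root counting applies. Otherwise each
    nonzero polynomial, multiplied by its sign at [y], is positive there, and such strict conditions
    are met near plus infinity, near minus infinity, or at a root of the derivative of the
    product. *)
Lemma point_signs_determined (F : seq {poly A}) (y : L) :
  sign_determined phi (fun S psi => exists b : S,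
    forall Q, Q \in F -> sgz (map_poly psi Q).[b] = sgz (map_poly phi Q).[y]).
Proof.
(* With ['X] in the list the product below is not constant, so its derivative is not zero. *)
wlog XF : F / 'X \in F.
  move=> h; have := h ('X :: F) (mem_head _ _).
  apply: sign_determined_impl => S psi [b hb]; exists b => Q QF.
  by apply: hb; rewrite inE QF orbT.
case: (pselect (exists2 P, P \in F & map_poly phi P != 0 /\ root (map_poly phi P) y)).
  by case=> P _ [P0 ry]; exact: root_signs_determined ry.
move=> noroot; pose sg Q : int := sgz (map_poly phi Q).[y].
pose F' := [seq Q <- F | map_poly phi Q != 0].
have sgF Q : Q \in F' -> sg Q != 0.
  rewrite mem_filter => /andP[Q0 QF]; rewrite sgz_eq0; apply/negP => ry.
  by apply: noroot; exists Q.
pose G := [seq (sg Q)%:~R *: Q | Q <- F'].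
pose im (S : rcfType) (psi : {rmorphism A -> S}) := [seq map_poly psi Q | Q <- G].
have imE S psi : im S psi = [seq (sg Q)%:~R *: map_poly psi Q | Q <- F'].
  rewrite /im /G -map_comp; apply: eq_map => Q /=.
  by rewrite map_polyZ /= rmorph_int.
have posL : \big[andb/true]_(q <- im L phi) (q.[y] > 0).
  rewrite imE big_map big_all; apply/allP => Q QF'.
  rewrite hornerZ -sgz_cp0 sgzM sgz_int.
  by have := sgF Q QF'; rewrite /sg; case: sgzP.
(* Equality of sizes makes [psi] kill every polynomial of the list that [phi] kills. *)
have zero_det : sign_determined phi (fun S psi =>
    forall Q, Q \in F -> size (map_poly psi Q) = size (map_poly phi Q) /\
    sgz (lead_coef (map_poly psi Q)) = sgz (lead_coef (map_poly phi Q))).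
  by apply: sign_determined_all => Q; exact: lead_coef_determined.
have concl (S : rcfType) (psi : {rmorphism A -> S}) (b : S) :
    (forall Q, Q \in F -> size (map_poly psi Q) = size (map_poly phi Q) /\
      sgz (lead_coef (map_poly psi Q)) = sgz (lead_coef (map_poly phi Q))) ->
    \big[andb/true]_(q <- im S psi) (q.[b] > 0) ->
    forall Q, Q \in F -> sgz (map_poly psi Q).[b] = sg Q.
  move=> hz; rewrite imE big_map big_all => /allP hb Q QF.
  have [Q0|Qn0] := eqVneq (map_poly phi Q) 0.
    have [] := hz Q QF; rewrite Q0 size_poly0 => /eqP.
    by rewrite size_poly_eq0 => /eqP-> _; rewrite /sg Q0 !horner0 !sgz0.
  have QF' : Q \in F' by rewrite mem_filter Qn0.
  have := hb Q QF'; rewrite hornerZ -sgz_cp0 sgzM sgz_int.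
  by have := sgF Q QF'; rewrite /sg; case: (sgzP (map_poly phi Q).[y]) => //;
     case: (sgzP (map_poly psi Q).[b]).
have lead_case (sgn : nat -> int) :
    (forall n, sgn n \in [:: 1; -1]) ->
    \big[andb/true]_(q <- im L phi) ((sgn (size q))%:~R * lead_coef q > 0) ->
    sign_determined phi (fun S psi =>
      (forall Q, Q \in F -> size (map_poly psi Q) = size (map_poly phi Q) /\
        sgz (lead_coef (map_poly psi Q)) = sgz (lead_coef (map_poly phi Q))) /\
      \big[andb/true]_(q <- im S psi) ((sgn (size q))%:~R * lead_coef q > 0)).
  move=> sgnE; rewrite imE big_map big_all => /allP h.
  apply: sign_determined_impl zero_det => S psi hz; split=> //.
  rewrite imE big_map big_all; apply/allP => Q QF'; have := h Q QF'.
  have QF : Q \in F by move: QF'; rewrite mem_filter => /andP[].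
  have [es el] := hz Q QF.
  have sg0 (T : rcfType) : (sg Q)%:~R != 0 :> T by rewrite intr_eq0 sgF.
  by rewrite !size_scale ?sg0 // es !lead_coefZ -!sgz_cp0 !sgzM !sgz_int el.
have [] := (bounding_polyP (im L phi)).2 (ex_intro _ y posL).
- move=> h; have [] := lead_case (fun=> 1).
  + by move=> n; rewrite inE.
  + by under eq_bigr do rewrite mul1r.
  move=> E hE; exists E => S psi /hE[hz hS].
  have [|b hb] := (bounding_polyP (im S psi)).1.
    by constructor 1; move: hS; under eq_bigr do rewrite mul1r.
  by exists b; apply: concl.
- move=> h; have sgnE (T : rcfType) (n : nat) : ((-1) ^+ n.-1 : int)%:~R = (-1) ^+ n.-1 :> T.
    by rewrite rmorphXn rmorphN1.
  have [] := lead_case (fun n => (-1) ^+ n.-1).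
  + by move=> n; rewrite -signr_odd; case: (odd _); rewrite ?expr0 ?expr1 !inE eqxx ?orbT.
  + by under eq_bigr do rewrite sgnE.
  move=> E hE; exists E => S psi /hE[hz hS].
  have [|b hb] := (bounding_polyP (im S psi)).1.
    by constructor 2; move: hS; under eq_bigr do rewrite sgnE.
  by exists b; apply: concl.
case=> x /andP[rx posx].
pose P0 := (\prod_(q <- G) q)^`().
have P0E : map_poly phi P0 = bounding_poly (im L phi).
  by rewrite /bounding_poly /P0 -deriv_map rmorph_prod /im big_map.
have P0n0 : map_poly phi P0 != 0.
  rewrite P0E /bounding_poly -derivn1 -polyorder.derivn_poly0 leq_eqVlt ltnS leqn0 negb_or.
  have prod0 : \prod_(q <- im L phi) q != 0.
    rewrite prodf_seq_neq0; apply/allP => q qim; apply/implyP => _.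
    move: posL; rewrite big_all => /allP/(_ q qim).
    by apply: contraTneq => ->; rewrite horner0 ltxx.
  rewrite size_poly_eq0 prod0 andbT; apply/size_prod_eq1 => /(_ ((sg 'X)%:~R *: 'X)).
  have XF' : 'X \in F' by rewrite mem_filter XF map_polyX polyX_eq0.
  rewrite size_scale ?intr_eq0 ?sgF // size_polyX imE => h.
  suff /h : (sg 'X)%:~R *: 'X \in [seq (sg Q)%:~R *: map_poly phi Q | Q <- F'] by [].
  by apply/mapP; exists 'X; rewrite // map_polyX.
apply: sign_determined_impl (@root_signs_determined F P0 x P0n0 _) => [S psi [b hb]|].
  exists b => Q QF; rewrite hb //; apply: (concl L phi) => //.
by rewrite P0E.
Qed.

End OneVariable.

Lemma mpoly_morphism_ext (n : nat) (R S : comNzRingType)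
    (f g : {rmorphism {mpoly R[n]} -> S}) :
  (forall c, f c%:MP = g c%:MP) -> (forall i, f 'X_i = g 'X_i) -> f =1 g.
Proof.
move=> fgC fgX p; rewrite (mpolyE p) !rmorph_sum; apply: eq_bigr => m _.
rewrite -mul_mpolyC !rmorphM fgC; congr (_ * _).
by rewrite mpolyXE_id !rmorph_prod; apply: eq_bigr => i _; rewrite !rmorphXn fgX.
Qed.

(** Positive elements are nonzero squares, so any morphism keeps them positive. *)
Lemma rcf_morphism_sgz (R L : rcfType) (f : {rmorphism R -> L}) (x : R) :
  sgz (f x) = sgz x.
Proof.
have pos y : 0 < y -> 0 < f y.
  move=> y0; rewrite -(sqr_sqrtr (ltW y0)) rmorphXn exprn_even_gt0 //=.
  by rewrite fmorph_eq0 sqrtr_eq0 -ltNge.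
case: (ltgtP x 0) => [x0|x0|->]; last by rewrite rmorph0 !sgz0.
  rewrite (ltr0_sgz x0) ltr0_sgz // -oppr_gt0 -rmorphN pos // oppr_gt0 //.
by rewrite (gtr0_sgz x0) gtr0_sgz // pos.
Qed.

(** Induction on the number of variables: viewed as polynomials in the last variable, the list has
    its signs at [z] decided by the signs of finitely many polynomials in the others, and those are
    realized over [R] by induction. *)
Lemma rcf_transfer (R L : rcfType) (f : {rmorphism R -> L}) (n : nat)
    (z : 'I_n -> L) (F : seq {mpoly R[n]}) :
  exists a : 'I_n -> R, forall P, P \in F -> sgz P.@[a] = sgz (mmap f z P).
Proof.
elim: n z F => [|n IH] z F.
  exists (fun=> 0) => P _; have [c ->] : exists c, P = c%:MP.
    exists P@_0%MM; apply/mpolyP => m; rewrite mcoeffC.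
    have -> : m = 0%MM by apply/mnmP; case.
    by rewrite eqxx mulr1.
  by rewrite mevalC mmapC rcf_morphism_sgz.
pose z' (i : 'I_n) := z (widen_ord (leqnSn n) i).
pose phi : {rmorphism {mpoly R[n]} -> L} := mmap f z'.
have [E hE] := point_signs_determined phi [seq muni P | P <- F] (z ord_max).
have [a agr] := IH z' E.
pose psi : {rmorphism {mpoly R[n]} -> R} := meval a.
have [b hb] := hE R psi agr.
pose a' (i : 'I_n.+1) := if unlift ord_max i is Some j then a j else b.
exists a' => P PF; have := hb (muni P) (map_f _ PF).
have split_eval (S : rcfType) (g : {rmorphism R -> S}) (u : 'I_n -> S) (y : S)
    (u' : 'I_n.+1 -> S) :
    (forall i, u' (widen_ord (leqnSn n) i) = u i) -> u' ord_max = y ->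
    (map_poly (mmap g u) (muni P)).[y] = mmap g u' P.
  move=> u'w u'y.
  pose G : {rmorphism {mpoly R[n.+1]} -> S} :=
    (horner_eval y \o map_poly (mmap g u)) \o @muni n R.
  rewrite -[LHS]/(G P); apply: mpoly_morphism_ext => [c|i].
    by rewrite /G /= muniC map_polyC /= /horner_eval hornerC !mmapC.
  rewrite /G /= [RHS]mmapX mmap1U [muni _]mmapX mmap1U /horner_eval.
  case: splitP => j ej.
    rewrite map_polyC hornerC /= mmapX mmap1U -u'w.
    by congr u'; apply: val_inj; rewrite /= -ej.
  rewrite map_polyX hornerX -u'y; congr u'; apply: val_inj.
  by move: ej; rewrite /= (ord1 j) addn0 => /esym.
rewrite (split_eval R idfun a b a') ?(split_eval L f z' (z ord_max) z) //.
  move=> i; rewrite /a'; case: unliftP => [j|] /(congr1 val) /=.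
    by rewrite /bump leqNgt ltn_ord add0n => e; congr a; apply/val_inj.
  by move: (ltn_ord i) => + e; rewrite e ltnn.
by rewrite /a' unlift_none.
Qed.

(** * Positive semidefinite forms and truncated moments *)

Definition ord_cons (T : Type) (n : nat) (x : T) (v : 'I_n -> T) (i : 'I_n.+1) : T :=
  if unlift ord0 i is Some j then v j else x.

Lemma ord_cons0 (T : Type) (n : nat) (x : T) (v : 'I_n -> T) :
  ord_cons x v ord0 = x.
Proof. by rewrite /ord_cons unlift_none. Qed.

Lemma ord_consS (T : Type) (n : nat) (x : T) (v : 'I_n -> T) (i : 'I_n) :
  ord_cons x v (lift ord0 i) = v i.
Proof. by rewrite /ord_cons liftK. Qed.

Definition quad_form (R : pzRingType) (n : nat) (H : 'I_n -> 'I_n -> R)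
    (v : 'I_n -> R) : R :=
  \sum_i \sum_j v i * v j * H i j.

Lemma quad_form_recl (R : comNzRingType) (n : nat) (H : 'I_n.+1 -> 'I_n.+1 -> R)
    (x : R) (v : 'I_n -> R) : (forall i j, H i j = H j i) ->
  quad_form H (ord_cons x v) =
    x ^+ 2 * H ord0 ord0 + 2%:R * x * \sum_i v i * H ord0 (lift ord0 i)
    + quad_form (fun i j => H (lift ord0 i) (lift ord0 j)) v.
Proof.
move=> sym; rewrite /quad_form big_ord_recl big_ord_recl ord_cons0.
have -> : \sum_(i < n) x * ord_cons x v (lift ord0 i) * H ord0 (lift ord0 i)
    = x * \sum_i v i * H ord0 (lift ord0 i).
  by rewrite mulr_sumr; apply: eq_bigr => i _; rewrite ord_consS mulrA.
have -> : \sum_(i < n) \sum_j ord_cons x v (lift ord0 i) * ord_cons x v j *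
      H (lift ord0 i) j
    = x * (\sum_i v i * H ord0 (lift ord0 i))
      + \sum_i \sum_j v i * v j * H (lift ord0 i) (lift ord0 j).
  rewrite mulr_sumr -big_split /=; apply: eq_bigr => i _.
  rewrite big_ord_recl ord_cons0 ord_consS; congr (_ + _).
    by rewrite sym; ring.
  by apply: eq_bigr => j _; rewrite ord_consS.
by ring.
Qed.

(* One step of Lagrange's reduction: the pivot [H 0 0] may vanish, in which case
   positivity kills the whole first row and [0^-1 = 0] does the rest. *)
Lemma psd_decomposition (K : realFieldType) (n : nat) (H : 'I_n -> 'I_n -> K) :
  (forall i j, H i j = H j i) -> (forall v, 0 <= quad_form H v) ->
  exists (c : 'I_n -> K) (l : 'I_n -> 'I_n -> K), (forall k, 0 <= c k) /\
    forall i j, H i j = \sum_k c k * l k i * l k j.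
Proof.
elim: n H => [|n IH] H sym psd.
  by exists (fun=> 0), (fun _ _ => 0); split=> // -[].
set a := H ord0 ord0; pose b i := H ord0 (lift ord0 i).
have a0 : 0 <= a.
  have := psd (ord_cons 1 (fun=> 0)); rewrite quad_form_recl // expr1n mul1r.
  rewrite big1 => [|i _]; last by rewrite mul0r.
  rewrite mulr0 addr0 [quad_form _ _]big1 ?addr0 // => i _.
  by rewrite big1 // => j _; rewrite mul0r mul0r.
have ab i : a * (a^-1 * b i) = b i.
  have [az|an0] := eqVneq a 0; last by rewrite mulrA divff ?mul1r.
  rewrite az mul0r; apply/esym/eqP; apply: contraT => bi0.
  pose h := H (lift ord0 i) (lift ord0 i).
  (* Chosen so that the form takes the value [2 * t * b i + h = - 1] when the pivot vanishes. *)
  pose t := - (h + 1) / (2%:R * b i).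
  have := psd (ord_cons t (fun j => (j == i)%:R)); rewrite quad_form_recl //.
  have delta (F : 'I_n -> K) : \sum_j (j == i)%:R * F j = F i.
    rewrite (bigD1 i) //= eqxx mul1r big1 ?addr0 // => j /negPf->.
    by rewrite mul0r.
  rewrite -/a az mulr0 add0r delta /quad_form.
  under eq_bigr => j _ do (under eq_bigr => k _ do rewrite -mulrA;
    rewrite -mulr_sumr delta).
  rewrite delta -/(b i) -/h.
  have -> : 2%:R * t * b i = - (h + 1) by rewrite /t; field.
  by rewrite opprD addrAC addNr add0r oppr_ge0 ler10.
have aaa : a^-1 * a * a^-1 = a^-1.
  by have [->|an0] := eqVneq a 0; [rewrite invr0 mulr0|rewrite mulVf ?mul1r].
pose S i j := H (lift ord0 i) (lift ord0 j) - a^-1 * b i * b j.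
have [|v|c [l [c0 Sl]]] := IH S.
- by move=> i j; rewrite /S sym mulrAC.
(* This first coordinate completes the square, leaving the form of the Schur complement [S]. *)
- have := psd (ord_cons (- a^-1 * \sum_i v i * b i) v).
  rewrite quad_form_recl // -/a.
  have -> : quad_form S v = quad_form (fun i j => H (lift ord0 i) (lift ord0 j)) v
      - a^-1 * (\sum_i v i * b i) ^+ 2.
    rewrite /quad_form expr2 mulr_sumr mulr_sumr -sumrB; apply: eq_bigr => i _.
    rewrite mulr_suml mulr_sumr -sumrB; apply: eq_bigr => j _.
    by rewrite /S; ring.
  set B := \sum_i v i * b i.
  have eB : \sum_i v i * H ord0 (lift ord0 i) = B by [].
  rewrite ?eB.
  have -> : (- a^-1 * B) ^+ 2 * a + 2%:R * (- a^-1 * B) * B =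
    (a^-1 * a * a^-1) * B ^+ 2 - 2%:R * a^-1 * B ^+ 2 by ring.
  by rewrite aaa; lra.
exists (ord_cons a c), (ord_cons (ord_cons 1 (fun i => a^-1 * b i))
  (fun k => ord_cons 0 (l k))); split.
  move=> k; rewrite /ord_cons; by case: (unlift _ _).
have lift0 i : i = ord0 \/ exists j, i = lift ord0 j :> 'I_n.+1.
  by case: (unliftP ord0 i) => [j|]; [right; exists j|left].
have rowS i j : H (lift ord0 i) (lift ord0 j) =
    a * (a^-1 * b i) * (a^-1 * b j) + \sum_k c k * l k i * l k j.
  by rewrite -Sl ab /S; ring.
move=> i j; rewrite big_ord_recl !ord_cons0.
under eq_bigr do rewrite !ord_consS.
case: (lift0 i) => [->|[i' ->]]; case: (lift0 j) => [->|[j' ->]].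
- rewrite !ord_cons0 !mulr1 big1 ?addr0 // => k _.
  by rewrite ord_cons0 mulr0.
- rewrite ord_cons0 ord_consS mulr1 ab big1 ?addr0 // => k _.
  by rewrite ord_cons0 mulr0 mul0r.
- rewrite ord_cons0 ord_consS mulr1 ab sym big1 ?addr0 // => k _.
  by rewrite ord_cons0 mulr0.
- rewrite !ord_consS rowS; congr (_ + _); apply: eq_bigr => k _.
  by rewrite !ord_consS.
Qed.

Lemma psd_of_decomposition (K : realFieldType) (n r : nat) (H : 'I_n -> 'I_n -> K)
    (c : 'I_r -> K) (l : 'I_r -> 'I_n -> K) (v : 'I_n -> K) :
  (forall k, 0 <= c k) -> (forall i j, H i j = \sum_k c k * l k i * l k j) ->
  0 <= quad_form H v.
Proof.
move=> c0 Hl; have -> : quad_form H v = \sum_k c k * (\sum_i v i * l k i) ^+ 2.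
  rewrite /quad_form; under eq_bigr => i _ do under eq_bigr => j _ do
    rewrite Hl mulr_sumr.
  under eq_bigr => i _ do rewrite exchange_big.
  rewrite exchange_big; apply: eq_bigr => k _.
  rewrite expr2 mulr_suml mulr_sumr; apply: eq_bigr => i _.
  rewrite !mulr_sumr; apply: eq_bigr => j _; ring.
by apply: sumr_ge0 => k _; rewrite mulr_ge0 // sqr_ge0.
Qed.

(** * Nonnegative univariate polynomials *)

(** If the cofactor [q] did not vanish at [r], it would keep its sign near [r] while ['X - r%:P]
    changes sign. *)
Lemma nonneg_double_root (R : rcfType) (p : {poly R}) (r : R) :
  (forall x, 0 <= p.[x]) -> root p r -> exists q, p = q * ('X - r%:P) ^+ 2.
Proof.
move=> p0 /factor_theorem[q pq].
suff /factor_theorem[u qu] : root q r by exists u; rewrite pq qu expr2 mulrA.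
apply/rootP/eqP; apply: contraT => qr0.
have [|e e0 he] := @poly_cont _ r q `|q.[r]|; first by rewrite normr_gt0.
have e2 : 0 < e / 2%:R by lra.
have q1 : 0 <= q.[r + e / 2%:R].
  have := p0 (r + e / 2%:R); rewrite pq hornerM hornerXsubC.
  by rewrite addrAC subrr add0r pmulr_lge0.
have q2 : q.[r - e / 2%:R] <= 0.
  have := p0 (r - e / 2%:R); rewrite pq hornerM hornerXsubC.
  by rewrite addrAC subrr add0r mulrN oppr_ge0 pmulr_lle0.
have n1 : `|q.[r + e / 2%:R] - q.[r]| < `|q.[r]|.
  by apply: he; rewrite addrAC subrr add0r gtr0_norm //; lra.
have n2 : `|q.[r - e / 2%:R] - q.[r]| < `|q.[r]|.
  by apply: he; rewrite addrAC subrr add0r normrN gtr0_norm //; lra.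
move: q1 q2 n1 n2; move: q.[r] q.[r - _] q.[r + _] qr0 => c u v c0.
case: (ltrgtP c 0) c0 => // c0 _; rewrite ?(gtr0_norm c0) ?(ltr0_norm c0) !ltr_norml; lra.
Qed.

(** A complex root a + ib has b nonzero. The remainder modulo (X - a)^2 + b^2 has degree at most 1,
    real coefficients, and vanishes at that root, so it is zero. *)
Lemma nonneg_quadratic_factor (R : rcfType) (p : {poly R}) :
  (1 < size p)%N -> (forall x, ~~ root p x) ->
  exists (a b : R) (q : {poly R}), b != 0 /\ p = q * (('X - a%:P) ^+ 2 + (b ^+ 2)%:P).
Proof.
move=> sp nr; pose toC : {rmorphism R -> R[i]} := real_complex R.
have [|z rz] := @closed_rootP _ (map_poly toC p) _.
  by rewrite size_map_poly; case: (size p) sp => [|[|]].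
case: z rz => a b rz.
have b0 : b != 0.
  apply: contraL rz => /eqP->; rewrite -[(a +i* 0)%C]/(toC a) fmorph_root.
  exact: nr.
pose s := ('X - a%:P) ^+ 2 + (b ^+ 2)%:P.
have ss : size s = 3%N.
  rewrite size_polyDl size_exp_XsubC // size_polyC.
  by case: eqP.
exists a, b, (p %/ s); split=> //; rewrite {1}(divp_eq p s) -/s.
suff -> : p %% s = 0 by rewrite addr0.
have sr : (size (p %% s)%R <= 2)%N.
  by rewrite -ltnS -ss ltn_modp -size_poly_eq0 ss.
have rs : (map_poly toC s).[(a +i* b)%C] = 0.
  rewrite rmorphD rmorphXn rmorphB /= map_polyX !map_polyC /= !hornerE.
  by apply/eqP; rewrite expr2 eq_complex /=; apply/andP; split; apply/eqP; ring.
move: rz; rewrite {1}(divp_eq p s) rmorphD rmorphM /= rootE hornerD hornerM rs mulr0 add0r.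
set r := p %% s in sr *.
have -> : r = (r`_1)%:P * 'X + (r`_0)%:P.
  apply/polyP => i; rewrite coefD coefMX !coefC; case: i => [|[|i]] /=; rewrite ?addr0 ?add0r //.
  by rewrite nth_default // (leq_trans sr).
rewrite rmorphD rmorphM /= map_polyX !map_polyC /= !hornerE.
rewrite eq_complex /= => /andP[/eqP e1 /eqP e2].
have r1 : r`_1 = 0.
  have : r`_1 * b = 0 by rewrite -[RHS]e2; ring.
  by move/eqP; rewrite mulf_eq0 (negPf b0) orbF => /eqP.
have r0 : r`_0 = 0 by rewrite -[RHS]e1 r1; ring.
by rewrite r0 r1 mul0r addr0.
Qed.

(** Multiplying a sum of the u^2 by (X - a)^2 + b^2 gives the sum of the (u (X - a))^2 and (b u)^2.
    The size bound says 2 deg q <= deg p, which lets a Hankel matrix of size d + 1 handle degree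
    2d. *)
Lemma nonneg_poly_sos (R : rcfType) (p : {poly R}) : (forall x, 0 <= p.[x]) ->
  exists2 qs : seq {poly R}, p = \sum_(q <- qs) q ^+ 2 &
    forall q, q \in qs -> (2 * size q <= (size p).+1)%N.
Proof.
elim: {p}(size p) {-2}p (leqnn (size p)) => [|n IH] p sp p0.
  by move: sp; rewrite size_poly_leq0 => /eqP->; exists [::]; rewrite ?big_nil.
have [sp1|sp1] := leqP (size p) 1.
  have pc := size1_polyC sp1; have c0 : 0 <= p`_0 by have := p0 0; rewrite pc hornerC coefC.
  exists [:: (Num.sqrt p`_0)%:P]; first by rewrite big_seq1 -rmorphXn /= sqr_sqrtr.
  move=> q; rewrite inE => /eqP->; rewrite pc !size_polyC coefC eqxx sqrtr_eq0.
  by case: (ltrgtP p`_0 0) c0.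
case: (pselect (exists r, root p r)) => [[r rr]|nr].
  have [q pq] := nonneg_double_root p0 rr.
  have q0 : q != 0 by apply: contraTneq sp1 => q0; rewrite pq q0 mul0r size_poly0.
  have sq : size p = (size q).+2.
    by rewrite pq size_mul ?expf_neq0 ?polyXsubC_eq0 // size_exp_XsubC addn3.
  have qpos x : 0 <= q.[x].
    have pos y : y != r -> 0 <= q.[y].
      move=> yr; have := p0 y; rewrite pq hornerM horner_exp hornerXsubC.
      by rewrite pmulr_lge0 // exprn_even_gt0 //= subr_eq0.
    have [->|] := eqVneq x r; last exact: pos.
    (* At [r] the factorization says nothing; the sign comes by continuity from nearby points. *)
    rewrite leNgt; apply/negP => qr; have [|e e0 he] := @poly_cont _ r q (- q.[r]).
      by rewrite oppr_gt0.
    have : `|q.[r + e / 2%:R] - q.[r]| < - q.[r].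
      by apply: he; rewrite addrAC subrr add0r gtr0_norm ?divr_gt0 //; lra.
    have : 0 <= q.[r + e / 2%:R].
      by apply: pos; rewrite -subr_eq0 addrAC subrr add0r gt_eqF // divr_gt0.
    by rewrite ltr_norml; lra.
  have [|qs qE qsz] := IH q _ qpos; first by rewrite -ltnS (leq_trans _ sp) // sq.
  exists [seq u * ('X - r%:P) | u <- qs].
    rewrite big_map pq qE mulr_suml; apply: eq_bigr => u _; by rewrite exprMn.
  move=> _ /mapP[u uqs ->]; have := qsz u uqs.
  have := size_polyMleq u ('X - r%:P); rewrite size_XsubC addn2 sq.
  by move: (size u) (size q) (size (u * _)%R) => i j k; lia.
have [|a [b [q [b0 pq]]]] := nonneg_quadratic_factor sp1 _.
  by move=> x; apply/negP => rx; apply: nr; exists x.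
have q0 : q != 0 by apply: contraTneq sp1 => q0; rewrite pq q0 mul0r size_poly0.
have ss : size (('X - a%:P) ^+ 2 + (b ^+ 2)%:P) = 3%N.
  by rewrite size_polyDl size_exp_XsubC // size_polyC; case: eqP.
have sq : size p = (size q).+2.
  by rewrite pq size_mul -?size_poly_eq0 ?ss ?size_poly_eq0 // addn3.
have qpos x : 0 <= q.[x].
  have := p0 x; rewrite pq hornerM !hornerE pmulr_lge0 //.
  by rewrite ltr_wpDl ?sqr_ge0 // exprn_even_gt0.
have [|qs qE qsz] := IH q _ qpos; first by rewrite -ltnS (leq_trans _ sp) // sq.
exists ([seq u * ('X - a%:P) | u <- qs] ++ [seq b *: u | u <- qs]).
  rewrite big_cat /= !big_map -big_split /= pq qE mulr_suml; apply: eq_bigr => u _.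
  by rewrite exprMn exprZn -mul_polyC; ring.
move=> v; rewrite mem_cat => /orP[] /mapP[u uqs ->]; have := qsz u uqs.
  have := size_polyMleq u ('X - a%:P); rewrite size_XsubC addn2 sq.
  by move: (size u) (size q) (size (u * _)%R) => i j k; lia.
by rewrite size_scale // sq => h; rewrite (leq_trans h) // ltnS ltnW.
Qed.

(** * Truncated moment sequences and power means *)

Definition moment_functional (R : nzRingType) (N : nat) (m : nat -> R)
    (p : {poly R}) : R :=
  \sum_(k < N) p`_k * m k.

Definition hankel (R : Type) (n : nat) (m : nat -> R) (i j : 'I_n) : R := m (i + j)%N.

Lemma moment_functional_sqr (R : comNzRingType) (d : nat) (m : nat -> R)
    (q : {poly R}) : (size q <= d.+1)%N ->
  moment_functional (2 * d).+1 m (q ^+ 2) =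
    quad_form (@hankel R d.+1 m) (fun i => q`_i).
Proof.
move=> sq; have qE : q = \sum_(i < d.+1) q`_i *: 'X^i.
  rewrite -poly_def; apply/polyP => i; rewrite coef_poly; case: ltnP => // le.
  by rewrite nth_default // (leq_trans sq).
have linZ c p : moment_functional (2 * d).+1 m (c *: p) =
    c * moment_functional (2 * d).+1 m p.
  by rewrite /moment_functional mulr_sumr; apply: eq_bigr => k _; rewrite coefZ mulrA.
have lin_sum (F : 'I_d.+1 -> {poly R}) : moment_functional (2 * d).+1 m (\sum_i F i) =
    \sum_i moment_functional (2 * d).+1 m (F i).
  rewrite /moment_functional exchange_big; apply: eq_bigr => k _.
  by rewrite coef_sum mulr_suml.
rewrite {1}qE expr2 big_distrlr /= lin_sum; apply: eq_bigr => i _.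
rewrite lin_sum; apply: eq_bigr => j _.
rewrite -scalerAl -scalerAr scalerA -exprD linZ /hankel; congr (_ * _).
have ij : (i + j < (2 * d).+1)%N by move: (ltn_ord i) (ltn_ord j); lia.
rewrite /moment_functional (bigD1 (Ordinal ij)) //= coefXn eqxx mul1r big1 ?addr0 //.
move=> k kij; rewrite coefXn; case: eqP => [e|_]; last by rewrite mul0r.
by case/eqP: kij; apply: val_inj.
Qed.

Lemma moment_functional_ge0 (R : rcfType) (d : nat) (m : nat -> R) (p : {poly R}) :
  (forall v, 0 <= quad_form (@hankel R d.+1 m) v) -> (size p <= (2 * d).+1)%N ->
  (forall x, 0 <= p.[x]) -> 0 <= moment_functional (2 * d).+1 m p.
Proof.
move=> psd sp /nonneg_poly_sos[qs pE qsz]; rewrite pE.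
have -> : moment_functional (2 * d).+1 m (\sum_(q <- qs) q ^+ 2) =
    \sum_(q <- qs) moment_functional (2 * d).+1 m (q ^+ 2).
  rewrite /moment_functional exchange_big; apply: eq_bigr => k _.
  by rewrite coef_sum mulr_suml.
rewrite big_seq sumr_ge0 // => q qqs; rewrite moment_functional_sqr //.
have : (2 * size q <= (2 * d).+2)%N by apply: leq_trans (qsz q qqs) _; rewrite ltnS.
by move: (size q) => i; lia.
Qed.

Definition repeat_seq (T : Type) (q : nat) (s : seq T) : seq T := flatten (nseq q s).

Lemma sum_repeat_seq (R : nzRingType) (T : Type) (q : nat) (s : seq T) (F : T -> R) :
  \sum_(x <- repeat_seq q s) F x = q%:R * \sum_(x <- s) F x.
Proof.
elim: q => [|q IH]; first by rewrite big_nil mul0r.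
by rewrite /repeat_seq /= big_cat /= -/(repeat_seq q s) IH mulrSr mulrDl mul1r addrC.
Qed.

(* The vectors [k |-> avg s c k] are the rational points of the cone spanned by
   the moment curve. *)
Definition avg (R : fieldType) (s : seq R) (c k : nat) : R :=
  (\sum_(x <- s) x ^+ k) / c%:R.

(** Multiplicities are natural numbers, so a move in the cone has step [1 / q]: [q] copies of [s]
    and [c] copies of [x], normalized by [c * q]. *)
Lemma avg_add_point (R : numFieldType) (s : seq R) (c q : nat) (x : R) (k : nat) :
  (0 < c)%N -> (0 < q)%N ->
  avg (repeat_seq q s ++ repeat_seq c [:: x]) (c * q) k = avg s c k + q%:R^-1 * x ^+ k.
Proof.
move=> c0 q0; rewrite /avg big_cat /= !sum_repeat_seq big_seq1 natrM.
by field; rewrite !pnatr_eq0 -!lt0n c0 q0.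
Qed.

(** The move towards the apex: one of [q] copies of [s] is dropped. *)
Lemma avg_shrink (R : numFieldType) (s : seq R) (c q : nat) (k : nat) :
  (0 < c)%N -> (0 < q)%N ->
  avg (repeat_seq q.-1 s) (c * q) k = avg s c k - q%:R^-1 * avg s c k.
Proof.
move=> c0; case: q => // q _; rewrite /avg sum_repeat_seq natrM /=.
have e : q%:R = q.+1%:R - 1 :> R by rewrite -natr1 addrK.
have q1 : q.+1%:R != 0 :> R by rewrite pnatr_eq0.
have cn0 : c%:R != 0 :> R by rewrite pnatr_eq0 -lt0n.
by rewrite e; move: q.+1%:R c%:R q1 cn0 => t u t0 u0; field; rewrite t0 u0.
Qed.

Definition dotp (R : pzRingType) (N : nat) (u v : nat -> R) : R :=
  \sum_(k < N) u k * v k.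

Lemma dotp_sub_scale (R : comNzRingType) (N : nat) (u v : nat -> R) (t : R) :
  dotp N (fun k => u k - t * v k) (fun k => u k - t * v k) =
    dotp N u u - 2%:R * t * dotp N u v + t ^+ 2 * dotp N v v.
Proof.
rewrite /dotp !mulr_sumr -sumrB -big_split /=; apply: eq_bigr => k _; ring.
Qed.

(** Replaces an ideal real step by the inverse of an integer, at the cost of a factor 2. *)
Lemma natr_between (R : archiRealFieldType) (x : R) : 1 <= x ->
  exists q : nat, [/\ (0 < q)%N, x <= q%:R & q%:R <= 2%:R * x].
Proof.
move=> x1; exists (Num.truncn x).+1; split=> //.
  by rewrite ltW // truncnS_gt.
have : (Num.truncn x)%:R <= x by rewrite truncn_le (le_trans ler01).
rewrite -[(Num.truncn x).+1%:R]natr1; lra.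
Qed.

Lemma moment_curve_bound (R : realFieldType) (d : nat) (x : R) :
  dotp (2 * d).+1 (fun k => x ^+ k) (fun k => x ^+ k) <=
    (2 * d).+1%:R * (1 + x ^+ (2 * d)) ^+ 2.
Proof.
have -> : (2 * d).+1%:R * (1 + x ^+ (2 * d)) ^+ 2 =
    \sum_(k < (2 * d).+1) (1 + x ^+ (2 * d)) ^+ 2 :> R.
  by rewrite sumr_const card_ord mulr_natl.
apply: ler_sum => k _; rewrite -expr2 -real_normK ?num_real //.
have e0 : 0 <= x ^+ (2 * d) by rewrite exprM exprn_ge0 ?sqr_ge0.
rewrite lerXn2r ?nnegrE ?addr_ge0 // normrX.
have [x1|x1] := leP `|x| 1; first by rewrite (le_trans (exprn_ile1 _ (normr_ge0 x) x1)) // lerDl.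
have : `|x| ^+ k <= `|x| ^+ (2 * d) by rewrite ler_weXn2l ?(ltW x1) // -ltnS.
by rewrite -[X in _ <= X -> _]normrX (ger0_norm e0); lra.
Qed.

(* Let y be a quasi-minimizer of the distance from m to the cone. Moving y towards
   the point of parameter x with a step of order tau / (1 + x^(2d)) bounds
   <m - y, (x^k)> by eta (1 + x^(2d)), uniformly in x: this replaces the
   compactness needed to find a minimizer and a separating hyperplane. *)
Lemma psd_moments_approx (R : realType) (d : nat) (m : nat -> R) :
  (forall v, 0 <= quad_form (@hankel R d.+1 m) v) -> forall delta : R, 0 < delta ->
  exists s c, (0 < c)%N /\
    dotp (2 * d).+1 (fun k => m k - avg s c k) (fun k => m k - avg s c k) < delta.
Proof.
move=> psd delta delta0; set N := (2 * d).+1.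
pose D s c := dotp N (fun k => m k - avg s c k) (fun k => m k - avg s c k).
have dotp_ge0 u : 0 <= dotp N u u :> R.
  by apply: sumr_ge0 => k _; rewrite -expr2 sqr_ge0.
pose S : set R := fun r => exists s c, (0 < c)%N /\ r = D s c.
have S0 : has_inf S.
  split; first by exists (D [::] 1%N), [::], 1%N.
  by exists 0 => _ [s [c [_ ->]]]; exact: dotp_ge0.
have infS s c : (0 < c)%N -> inf S <= D s c.
  by move=> c0; apply: ge_inf; [case: S0|exists s, c].
(* [Y] bounds the squared norm of y: it is at most 2 |m|^2 + 2 |m - y|^2, and |m - y|^2 <= M + 1 by
   comparison with the empty list. [tau * C0] is the sum of the final estimates, and [tau] is chosen
   to bring it below [delta]. *)
pose M := dotp N m m; pose Y := 4%:R * M + 2%:R.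
pose C0 := (1 + N%:R / 2%:R) * (m 0%N + m (2 * d)%N) + 1 + Y / 2%:R.
pose C := `|C0| + 1.
have C_gt0 : 0 < C by rewrite ltr_wpDl.
pose tau := Num.min 1 (delta / (2%:R * C)).
have tau0 : 0 < tau by rewrite lt_min ltr01 divr_gt0 // mulr_gt0.
have tau1 : tau <= 1 by rewrite ge_min lexx.
have tauC : tau * C0 < delta.
  have : tau * C <= delta / 2%:R.
    have -> : delta / 2%:R = delta / (2%:R * C) * C by field; rewrite gt_eqF.
    by rewrite ler_pM2r // ge_min lexx orbT.
  have : tau * C0 <= tau * C.
    by rewrite ler_pM2l // /C; have := ler_norm C0; lra.
  lra.
have [|_ [s [c [c0 ->]]] Dlt] := @inf_adherent R S (tau ^+ 2) _ S0.
  by rewrite exprn_gt0.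
pose u k := m k - avg s c k; rewrite -/(D s c) in Dlt *.
have DE : D s c = dotp N u u by [].
have MlY : dotp N (avg s c) (avg s c) <= Y.
  have : D s c <= M + 1.
    have : inf S <= M.
      have := infS [::] 1%N isT; congr (_ <= _); apply: eq_bigr => k _.
      by rewrite /avg big_nil mul0r subr0.
    have : tau ^+ 2 <= 1 by rewrite expr_le1 // ltW.
    lra.
  suff : dotp N (avg s c) (avg s c) <= 2%:R * M + 2%:R * D s c by rewrite /Y; lra.
  rewrite /M /D /dotp !mulr_sumr -big_split; apply: ler_sum => k _ /=.
  move: (m k) (avg s c k) => a b; rewrite -subr_ge0.
  have -> : 2%:R * (a * a) + 2%:R * ((a - b) * (a - b)) - b * b = (2%:R * a - b) ^+ 2.
    by ring.
  exact: sqr_ge0.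
pose eta := tau * (1 + N%:R / 2%:R).
(* With t = 1 / q, quasi-minimality gives 2 t <u, v> <= tau^2 + t^2 |v|^2 for v the point at [x].
   Multiplying by q, which lies between w / tau and 2 w / tau, gives the claim. *)
have step1 x : dotp N u (fun k => x ^+ k) <= eta * (1 + x ^+ (2 * d)).
  pose w := 1 + x ^+ (2 * d).
  have w1 : 1 <= w by rewrite lerDl exprM exprn_ge0 ?sqr_ge0.
  have [|q [q0 wq qw]] := @natr_between R (w / tau).
    by rewrite ler_pdivlMr // mul1r (le_trans tau1).
  have q_gt0 : 0 < q%:R :> R by rewrite ltr0n.
  have := infS (repeat_seq q s ++ repeat_seq c [:: x]) (c * q)%N.
  rewrite muln_gt0 c0 q0 => /(_ isT).
  have -> : D (repeat_seq q s ++ repeat_seq c [:: x]) (c * q)%N =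
      dotp N (fun k => u k - q%:R^-1 * x ^+ k) (fun k => u k - q%:R^-1 * x ^+ k).
    by apply: eq_bigr => k _; rewrite avg_add_point // /u; ring.
  rewrite dotp_sub_scale -DE; move: (moment_curve_bound d x).
  rewrite -/N -/w; set a := dotp N u _; set V := dotp N _ _ => VN ineq.
  have qt : q%:R * q%:R^-1 = 1 :> R by rewrite divff // gt_eqF.
  have t0 : 0 < q%:R^-1 :> R by rewrite invr_gt0.
  move: (q%:R : R) (q%:R^-1 : R) wq qw q_gt0 qt t0 ineq => Q t wq qw Q0 Qt t0 ineq.
  have h1 : Q * tau ^+ 2 <= 2%:R * w * tau.
    have -> : 2%:R * w * tau = 2%:R * (w / tau) * tau ^+ 2 by field; rewrite gt_eqF.
    by rewrite ler_pM2r // exprn_gt0.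
  have h2 : t * w <= tau.
    have : w <= Q * tau by rewrite -ler_pdivrMr.
    by rewrite -(ler_pM2l t0) mulrA [t * Q]mulrC Qt mul1r.
  have h3 : t ^+ 2 * V <= t ^+ 2 * (N%:R * w ^+ 2) by rewrite ler_pM2l // exprn_gt0.
  have h4 : 2%:R * t * a <= tau ^+ 2 + t ^+ 2 * (N%:R * w ^+ 2) by lra.
  have h5 : 2%:R * a <= Q * tau ^+ 2 + (N%:R * w) * (t * w).
    have -> : 2%:R * a = Q * (2%:R * t * a).
      by rewrite -[LHS]mul1r -Qt; ring.
    have -> : Q * tau ^+ 2 + N%:R * w * (t * w) = Q * (tau ^+ 2 + t ^+ 2 * (N%:R * w ^+ 2)).
      by rewrite -[N%:R * w * (t * w)]mul1r -Qt; ring.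
    by rewrite ler_pM2l.
  have h6 : N%:R * w * (t * w) <= N%:R * w * tau.
    by rewrite ler_wpM2l // mulr_ge0 // (le_trans ler01).
  have -> : eta * w = (2%:R * w * tau + N%:R * w * tau) / 2%:R by rewrite /eta; field.
  lra.
(* The same argument for the move towards the apex, with q between 1 / tau and 2 / tau. *)
have step2 : - dotp N u (avg s c) <= tau + tau * Y / 2%:R.
  have [|q [q0 wq qw]] := @natr_between R (1 / tau).
    by rewrite ler_pdivlMr // mul1r.
  have q_gt0 : 0 < q%:R :> R by rewrite ltr0n.
  have := infS (repeat_seq q.-1 s) (c * q)%N.
  rewrite muln_gt0 c0 q0 => /(_ isT).
  have -> : D (repeat_seq q.-1 s) (c * q)%N =
      dotp N (fun k => u k - (- q%:R^-1) * avg s c k) (fun k => u k - (- q%:R^-1) * avg s c k).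
    by apply: eq_bigr => k _; rewrite avg_shrink // /u; ring.
  rewrite dotp_sub_scale -DE.
  move: MlY; set b := dotp N u _; set V := dotp N _ _ => VY ineq.
  have qt : q%:R * q%:R^-1 = 1 :> R by rewrite divff // gt_eqF.
  have t0 : 0 < q%:R^-1 :> R by rewrite invr_gt0.
  move: (q%:R : R) (q%:R^-1 : R) wq qw q_gt0 qt t0 ineq => Q t wq qw Q0 Qt t0 ineq.
  have h1 : Q * tau ^+ 2 <= 2%:R * tau.
    have -> : 2%:R * tau = 2%:R * (1 / tau) * tau ^+ 2 by field; rewrite gt_eqF.
    by rewrite ler_pM2r // exprn_gt0.
  have h2 : t <= tau.
    have : 1 <= Q * tau by rewrite -ler_pdivrMr.
    by rewrite -(ler_pM2l t0) mulrA [t * Q]mulrC Qt mul1r mulr1.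
  have V0 : 0 <= V by exact: dotp_ge0.
  have Y0 : 0 <= Y by exact: le_trans V0 VY.
  have h3 : t ^+ 2 * V <= t ^+ 2 * Y by rewrite ler_pM2l // exprn_gt0.
  have h4 : - (2%:R * t * b) <= tau ^+ 2 + t ^+ 2 * Y by lra.
  have h5 : - (2%:R * b) <= Q * tau ^+ 2 + t * Y.
    have -> : - (2%:R * b) = Q * - (2%:R * t * b).
      by rewrite -[LHS]mul1r -Qt; ring.
    have -> : Q * tau ^+ 2 + t * Y = Q * (tau ^+ 2 + t ^+ 2 * Y).
      by rewrite -[t * Y]mul1r -Qt; ring.
    by rewrite ler_pM2l.
  have h6 : t * Y <= tau * Y by rewrite ler_wpM2r.
  lra.
(* Nonnegative by [step1]; its moment functional bounds [dotp N u m] by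
   [eta * (m 0 + m (2 * d))]. *)
pose P : {poly R} := eta *: (1 + 'X^(2 * d)) - \poly_(k < N) u k.
have Psize : (size P <= N)%N.
  rewrite (leq_trans (size_polyD _ _)) // geq_max size_polyN size_poly andbT.
  rewrite (leq_trans (size_scale_leq _ _)) // (leq_trans (size_polyD _ _)) //.
  by rewrite geq_max size_polyXn size_poly1 leqnn.
have Ppos x : 0 <= P.[x].
  rewrite hornerD hornerN hornerZ hornerD hornerXn hornerC horner_poly subr_ge0.
  exact: step1.
have := moment_functional_ge0 psd Psize Ppos.
have -> : moment_functional N m P = eta * (m 0%N + m (2 * d)%N) - dotp N u m.
  have delta_sum j : (j < N)%N -> \sum_(k < N) (k == j :> nat)%:R * m k = m j.
    move=> jN; rewrite (bigD1 (Ordinal jN)) //= eqxx mul1r big1 ?addr0 // => k kj.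
    by case: eqP => [e|_]; rewrite ?mul0r //; case/eqP: kj; apply: val_inj.
  rewrite -(delta_sum 0%N) // -(delta_sum (2 * d)%N) // /dotp -big_split mulr_sumr -sumrB.
  apply: eq_bigr => k _ /=.
  by rewrite /P coefB coefZ coefD coef1 coefXn coef_poly ltn_ord; ring.
move=> step3; exists s, c; split=> //; apply: le_lt_trans tauC.
have -> : dotp N u u = dotp N u m - dotp N u (avg s c).
  by rewrite /dotp -sumrB; apply: eq_bigr => k _; rewrite /u; ring.
have -> : tau * C0 = eta * (m 0%N + m (2 * d)%N) + (tau + tau * Y / 2%:R).
  by rewrite /C0 /eta; field.
lra.
Qed.

Lemma mpoly_continuous (R : realFieldType) (n : nat) (h : {mpoly R[n]})
    (a : 'I_n -> R) (eps : R) : 0 < eps ->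
  exists2 delta : R, 0 < delta & forall u : 'I_n -> R,
    (forall i, `|u i - a i| < delta) -> `|h.@[u] - h.@[a]| < eps.
Proof.
pose cont (f : ('I_n -> R) -> R) := forall eps : R, 0 < eps ->
  exists2 delta : R, 0 < delta & forall u : 'I_n -> R,
    (forall i, `|u i - a i| < delta) -> `|f u - f a| < eps.
have cont_cst c : cont (fun=> c).
  by move=> e e0; exists 1 => // u _; rewrite subrr normr0.
have cont_add f g : cont f -> cont g -> cont (fun u => f u + g u).
  move=> cf cg e e0; have e2 : 0 < e / 2%:R by lra.
  have [d d0 hd] := cf _ e2; have [d' d'0 hd'] := cg _ e2.
  exists (Num.min d d') => [|u hu]; first by rewrite lt_min d0.
  rewrite opprD addrACA (le_lt_trans (ler_normD _ _)) //.
  suff [h1 h2] : `|f u - f a| < e / 2%:R /\ `|g u - g a| < e / 2%:R by lra.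
  by split; [apply: hd|apply: hd'] => i; have := hu i; rewrite lt_min => /andP[].
have cont_mul f g : cont f -> cont g -> cont (fun u => f u * g u).
  move=> cf cg e e0; pose F := `|f a| + 1; pose G := `|g a| + 1.
  have F0 : 0 < F by rewrite ltr_wpDl.
  have G0 : 0 < G by rewrite ltr_wpDl.
  have [|d d0 hd] := cf (Num.min 1 (e / (2%:R * G))).
    by rewrite lt_min ltr01 divr_gt0 // mulr_gt0.
  have [|d' d'0 hd'] := cg (e / (2%:R * F)); first by rewrite divr_gt0 // mulr_gt0.
  exists (Num.min d d') => [|u hu]; first by rewrite lt_min d0.
  have hf : `|f u - f a| < Num.min 1 (e / (2%:R * G)).
    by apply: hd => i; have := hu i; rewrite lt_min => /andP[].
  have hg : `|g u - g a| < e / (2%:R * F).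
    by apply: hd' => i; have := hu i; rewrite lt_min => /andP[].
  move: hf; rewrite lt_min => /andP[hf1 hf].
  have fuF : `|f u| <= F.
    have -> : f u = f a + (f u - f a) by ring.
    by rewrite (le_trans (ler_normD _ _)) // lerD2l ltW.
  have -> : f u * g u - f a * g a = (f u - f a) * g a + f u * (g u - g a) by ring.
  rewrite (le_lt_trans (ler_normD _ _)) // !normrM.
  have t1 : `|f u - f a| * `|g a| <= e / (2%:R * G) * G.
    by apply: ler_pM => //; [exact: ltW|rewrite lerDl].
  have t2 : `|f u| * `|g u - g a| < F * (e / (2%:R * F)).
    apply: le_lt_trans (ler_wpM2r (normr_ge0 _) fuF) _.
    by rewrite ltr_pM2l.
  have e1 : e / (2%:R * G) * G = e / 2%:R by field; rewrite gt_eqF.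
  have e2 : F * (e / (2%:R * F)) = e / 2%:R by field; rewrite gt_eqF.
  lra.
have cont_proj i : cont (fun u => u i).
  by move=> e e0; exists e => // u; exact.
suff : cont (fun u => h.@[u]) by exact.
elim/mpolyind: h => [|c m p _ _ IH].
  by move=> e e0; exists 1 => // u _; rewrite !meval0 subrr normr0.
suff : cont (fun u => c * (\prod_(i < n) u i ^+ m i) + p.@[u]).
  by move=> h e /h[d d0 hd]; exists d => // u /hd; rewrite !mevalD !mevalZ !mevalX.
apply: (cont_add _ _) => //; apply: (cont_mul _ _) => //.
elim: (index_enum _) => [|i s IHs].
  by move=> e e0; exists 1 => // u _; rewrite !big_nil subrr normr0.
suff : cont (fun u => u i ^+ m i * \prod_(j <- s) u j ^+ m j).
  by move=> h e /h[d d0 hd]; exists d => // u /hd; rewrite !big_cons.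
apply: (cont_mul _ _) => //; elim: (m i) => [|k IHk].
  by move=> e e0; exists 1 => // u _; rewrite !expr0 subrr normr0.
suff : cont (fun u => u i * u i ^+ k).
  by move=> h e /h[d d0 hd]; exists d => // u /hd; rewrite !exprS.
exact: cont_mul.
Qed.

Lemma power_mean_eval (R : realType) (n k : nat) (x : 'I_n -> R) :
  (power_mean R n k).@[x] = n%:R^-1 * \sum_(i < n) x i ^+ k.
Proof.
rewrite mevalZ rmorph_sum; congr (_ * _); apply: eq_bigr => i _.
by rewrite rmorphXn /= mevalXU.
Qed.

(** An approximating cone point has total mass [avg s c 0] close to [m 0 = 1]; dividing by that mass
    turns it into power means of the entries of [s]. *)
Lemma psd_moments_closure (R : realType) (d : nat) (m : nat -> R) (eps : R) :
  m 0%N = 1 -> (forall v, 0 <= quad_form (@hankel R d.+1 m) v) -> 0 < eps ->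
  exists n (x : 'I_n -> R), (0 < n)%N /\
    forall k : 'I_(2 * d), `|(power_mean R n k.+1).@[x] - m k.+1| < eps.
Proof.
move=> m0 psd eps0; pose B := \sum_(k < (2 * d).+1) `|m k|.
have B0 : 0 <= B by apply: sumr_ge0.
have B1 : 0 < 1 + B by rewrite ltr_pwDl.
(* The bound 1/2 keeps the mass above 1/2, so [s] is nonempty. The other bound leaves an error of at
   most [delta * (1 + B)] over the mass, hence below [eps / 2]. *)
pose delta := Num.min (2%:R^-1) (eps / (4%:R * (1 + B))).
have d0 : 0 < delta by rewrite lt_min invr_gt0 ltr0n /= divr_gt0 // mulr_gt0.
have dhalf : delta <= 2%:R^-1 by rewrite ge_min lexx.
have dB : delta * (1 + B) <= eps / 4%:R.
  have -> : eps / 4%:R = eps / (4%:R * (1 + B)) * (1 + B) by field; rewrite gt_eqF.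
  by rewrite ler_pM2r // ge_min lexx orbT.
have [|s [c [c0 close]]] := psd_moments_approx psd (delta := delta ^+ 2).
  by rewrite exprn_gt0.
have coord k : (k < (2 * d).+1)%N -> `|m k - avg s c k| < delta.
  move=> kN; rewrite -(@ltr_pXn2r R 2) ?nnegrE ?(ltW d0) // real_normK ?num_real //.
  apply: le_lt_trans close; rewrite /dotp (bigD1 (Ordinal kN)) //= -expr2 lerDl.
  by apply: sumr_ge0 => i _; rewrite -expr2 sqr_ge0.
have y0E : avg s c 0 = (size s)%:R / c%:R.
  by rewrite /avg; under eq_bigr do rewrite expr0; rewrite big_const_seq count_predT iter_addr_0.
have y0 : 2%:R^-1 < avg s c 0.
  by have := coord 0%N isT; rewrite m0 ltr_norml; lra.
have s0 : (0 < size s)%N.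
  by rewrite lt0n; apply: contraTneq y0 => s0; rewrite y0E s0 mul0r -leNgt invr_ge0 ler0n.
exists (size s), (fun i => nth 0 s i); split=> // k.
have kN : (k.+1 < (2 * d).+1)%N by rewrite ltnS ltn_ord.
have ck := coord _ kN; have c00 := coord 0%N isT.
have -> : (power_mean R (size s) k.+1).@[fun i => nth 0 s i] =
    avg s c k.+1 / avg s c 0.
  rewrite power_mean_eval y0E /avg (big_nth 0) big_mkord.
  by field; rewrite !pnatr_eq0 -!lt0n c0 s0.
have mB : `|m k.+1| <= B.
  rewrite /B (bigD1 (Ordinal kN)) //= lerDl; exact: sumr_ge0.
have -> : avg s c k.+1 / avg s c 0 - m k.+1 =
    ((avg s c k.+1 - m k.+1) + m k.+1 * (1 - avg s c 0)) / avg s c 0.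
  by field; rewrite gt_eqF // (lt_trans _ y0) // invr_gt0 ltr0n.
have yp : 0 < avg s c 0 by rewrite (lt_trans _ y0) // invr_gt0 ltr0n.
rewrite normrM normfV (gtr0_norm yp) ltr_pdivrMr //.
apply: le_lt_trans (ler_normD _ _) _; rewrite normrM distrC.
rewrite m0 in c00.
have t1 : `|m k.+1| * `|1 - avg s c 0| <= B * delta.
  by apply: ler_pM => //; exact: ltW.
have t2 : eps / 2%:R < eps * avg s c 0.
  by rewrite ltr_pM2l.
have : delta + B * delta <= eps / 4%:R by move: dB; rewrite mulrDr mulr1 [delta * B]mulrC.
lra.
Qed.

(** * Sums of squares of normalized symmetric functions *)

Section SumsOfSquares.
Variables (R : realType) (d : nat).
Local Notation A := {mpoly R[2 * d]}.

Lemma is_sos_poly_add (n : nat) (g h : {mpoly R[n]}) :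
  is_sos_poly g -> is_sos_poly h -> is_sos_poly (g + h).
Proof. by move=> [s ->] [t ->]; exists (s ++ t); rewrite big_cat. Qed.

Lemma is_sos_poly_mul (n : nat) (g h : {mpoly R[n]}) :
  is_sos_poly g -> is_sos_poly h -> is_sos_poly (g * h).
Proof.
move=> [s ->] [t ->]; exists [seq x * y | x <- s, y <- t].
rewrite big_allpairs_dep big_distrl; apply: eq_bigr => x _.
by rewrite big_distrr; apply: eq_bigr => y _; rewrite exprMn.
Qed.

(* [subst_pvar] and [realize n] up to conversion, as ring morphisms. *)
Definition theta_subst : {rmorphism A -> Theta R} :=
  mmap (@malgC {cmonom nat} R) (fun i : 'I_(2 * d) => pvar R i).

Lemma theta_substE (h : A) : theta_subst h = subst_pvar h.
Proof. by []. Qed.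

Definition realize_morph (n : nat) : {rmorphism Theta R -> {mpoly R[n]}} :=
  malg_eval (@mpolyC n R) (fun k => power_mean R n k.+1).

Lemma realize_subst_eval (n : nat) (h : A) (x : 'I_n -> R) :
  (realize n (subst_pvar h)).@[x] = h.@[fun i => (power_mean R n i.+1).@[x]].
Proof.
pose u : {rmorphism A -> R} := (meval x \o realize_morph n) \o theta_subst.
pose v : {rmorphism A -> R} := meval (fun i : 'I_(2 * d) => (power_mean R n i.+1).@[x]).
rewrite -[LHS]/(u h) -[RHS]/(v h); apply: mpoly_morphism_ext => [c|i].
  by rewrite /u /v /= mmapC [malg_eval _ _ _]malg_evalC !mevalC.
by rewrite /u /v /= mmapX mmap1U [malg_eval _ _ _]malg_evalX mevalXU.
Qed.

Definition sos_pred (a : A) : Prop := is_sos (subst_pvar a).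

Lemma sos_predE (a : A) :
  sos_pred a = forall n, (0 < n)%N -> is_sos_poly (realize_morph n (theta_subst a)).
Proof. by []. Qed.

Lemma sos_pred_preordering : preordering sos_pred.
Proof.
split=> [a b ha hb|a b ha hb|a]; rewrite sos_predE => n n0.
- by rewrite !rmorphD; apply: is_sos_poly_add; [exact: ha|exact: hb].
- by rewrite !rmorphM; apply: is_sos_poly_mul; [exact: ha|exact: hb].
- by rewrite !rmorphXn; exists [:: realize_morph n (theta_subst a)]; rewrite big_seq1.
Qed.

(** Index 0 is the total mass 1, and the variable of index [i] is the moment of order [i + 1].
    Beyond [2 * d] the value 0 is junk, out of reach of a Hankel matrix of size [d + 1]. *)
Definition moment_var (T : nzRingType) (v : 'I_(2 * d) -> T) (k : nat) : T :=
  if k is j.+1 then (if insub j is Some i then v i else 0) else 1.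

Lemma moment_var_morph (S T : nzRingType) (f : {rmorphism S -> T})
    (v : 'I_(2 * d) -> S) k : f (moment_var v k) = moment_var (f \o v) k.
Proof.
by case: k => [|k] /=; rewrite ?rmorph1 //; case: insub => [i|] //=; rewrite rmorph0.
Qed.

Lemma eq_moment_var (T : nzRingType) (v w : 'I_(2 * d) -> T) (k : nat) :
  v =1 w -> moment_var v k = moment_var w k.
Proof. by move=> vw; case: k => //= k; case: insub. Qed.

Lemma moment_varS (T : nzRingType) (v : 'I_(2 * d) -> T) (i : 'I_(2 * d)) :
  moment_var v i.+1 = v i.
Proof. by rewrite /= valK. Qed.

Definition hankel_form (w : 'I_d.+1 -> A) : A :=
  quad_form (hankel (moment_var (fun i => 'X_i))) w.

Lemma hankel_form_sos (w : 'I_d.+1 -> A) : sos_pred (hankel_form w).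
Proof.
rewrite sos_predE => n n0; pose g : {rmorphism A -> {mpoly R[n]}} :=
  realize_morph n \o theta_subst.
rewrite -[X in is_sos_poly X]/(g _).
(* For [k = 0] the power mean is 1 because [n] is positive. *)
have gmom k : (k <= 2 * d)%N -> g (moment_var (fun i => 'X_i) k) = power_mean R n k.
  case: k => [_|k kd]; rewrite moment_var_morph /=.
    rewrite /power_mean /power_sum; under eq_bigr do rewrite expr0.
    by rewrite sumr_const card_ord -scaler_nat scalerA mulVf ?scale1r // pnatr_eq0 -lt0n.
  rewrite insubT /= [malg_eval _ _ _](_ : _ = power_mean R n k.+1) //.
  by rewrite mmapX mmap1U malg_evalX.
clearbody g.
have -> : g (hankel_form w) =
    \sum_i \sum_j g (w i) * g (w j) * power_mean R n (i + j).
  rewrite /hankel_form /quad_form rmorph_sum; apply: eq_bigr => i _.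
  rewrite rmorph_sum; apply: eq_bigr => j _; rewrite !rmorphM /hankel gmom //.
  by move: (ltn_ord i) (ltn_ord j); lia.
(* One square per variable ['X_l]; the weight [1 / n] enters the square as its root. *)
exists [seq (Num.sqrt (n%:R^-1 : R))%:MP * \sum_(i < d.+1) g (w i) * 'X_l ^+ i
        | l <- index_enum 'I_n].
rewrite big_map.
have -> : \sum_i \sum_j g (w i) * g (w j) * power_mean R n (i + j) =
    \sum_(l < n) \sum_i \sum_j
      (n%:R^-1)%:MP * ((g (w i) * 'X_l ^+ i) * (g (w j) * 'X_l ^+ j)).
  rewrite [RHS]exchange_big; apply: eq_bigr => i _.
  rewrite [RHS]exchange_big; apply: eq_bigr => j _.
  rewrite /power_mean /power_sum -mul_mpolyC mulrCA mulr_sumr mulr_sumr.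
  by apply: eq_bigr => l _; rewrite exprD; ring.
apply: eq_bigr => l _; rewrite exprMn -rmorphXn /= sqr_sqrtr ?invr_ge0 //.
rewrite expr2 mulr_suml mulr_sumr; apply: eq_bigr => i _.
by rewrite !mulr_sumr.
Qed.

End SumsOfSquares.

(** * From an ordered field to a real point and a certificate *)

(** Scaling a vector over [K] by [f D] brings it into the image of [A], where Hankel forms are known
    to be sums of squares. *)
Lemma common_denominator (A : comNzRingType) (K : fieldType) (f : {rmorphism A -> K})
    (n : nat) (v : 'I_n -> K) :
  (forall x, exists a b, f b != 0 /\ x = f a / f b) ->
  exists D (w : 'I_n -> A), f D != 0 /\ forall i, v i = f (w i) / f D.
Proof.
move=> fr; elim: n v => [|n IH] v.
  by exists 1, (fun=> 0); rewrite rmorph1 oner_neq0; split=> // -[].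
have [D [w [D0 vw]]] := IH (fun i => v (lift ord0 i)).
have [a [b [b0 va]]] := fr (v ord0).
exists (D * b), (ord_cons (a * D) (fun i => w i * b)); rewrite rmorphM.
split=> [|i]; first by rewrite mulf_neq0.
case: (unliftP ord0 i) => [j|] ->.
  by rewrite ord_consS vw rmorphM; field; rewrite D0 b0.
by rewrite ord_cons0 va rmorphM; field; rewrite D0 b0.
Qed.

Lemma real_moment_point (R : realType) (d : nat) (h : {mpoly R[2 * d]})
    (K : realFieldType) (f : {rmorphism {mpoly R[2 * d]} -> K}) :
  (forall a, sos_pred a -> 0 <= f a) ->
  (forall x, exists a b, f b != 0 /\ x = f a / f b) ->
  exists a : 'I_(2 * d) -> R,
    (forall v, 0 <= quad_form (@hankel R d.+1 (moment_var a)) v) /\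
    sgz h.@[a] = sgz (f h).
Proof.
move=> fsos fr; pose p i := f 'X_i.
have psdK v : 0 <= quad_form (@hankel K d.+1 (moment_var p)) v.
  have [D [w [D0 vw]]] := common_denominator v fr.
  have -> : quad_form (hankel (moment_var p)) v = f (hankel_form w) / f D ^+ 2.
    rewrite /quad_form rmorph_sum mulr_suml; apply: eq_bigr => i _.
    rewrite rmorph_sum mulr_suml; apply: eq_bigr => j _.
    rewrite !rmorphM /hankel moment_var_morph !vw -/p.
    by rewrite [moment_var (f \o _) _](_ : _ = moment_var p (i + j)) //; field.
  by rewrite divr_ge0 ?sqr_ge0 // fsos //; exact: hankel_form_sos.
have [|c [l [c0 Hl]]] := psd_decomposition _ psdK.
  by move=> i j; rewrite /hankel addnC.
have [L [g gmono]] := real_closure_exists K.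
(* The unknowns: the [2 * d] moments, the weights c_k, and the coordinates of the vectors l_k. *)
pose V := ('I_(2 * d) + ('I_d.+1 + 'I_d.+1 * 'I_d.+1))%type.
pose val_of (v : V) : L := match v with
  | inl i => g (p i) | inr (inl k) => g (c k) | inr (inr (k, i)) => g (l k i) end.
pose z (i : 'I_#|{: V}|) : L := val_of (enum_val i).
pose B := {mpoly R[#|{: V}|]}.
pose X (v : V) : B := 'X_(enum_rank v).
pose iota : {rmorphism R -> L} := (g \o f) \o @mpolyC (2 * d) R.
pose ev : {rmorphism B -> L} := mmap iota z.
have evX v : ev (X v) = val_of v by rewrite /ev /= mmapX mmap1U /z enum_rankK.
pose lft : {rmorphism {mpoly R[2 * d]} -> B} :=
  mmap (@mpolyC _ R) (fun i => X (inl i)).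
pose relation (i j : 'I_d.+1) := moment_var (fun i => X (inl i)) (i + j) -
  \sum_k X (inr (inl k)) * X (inr (inr (k, i))) * X (inr (inr (k, j))).
pose F := lft h :: [seq X (inr (inl k)) | k <- index_enum 'I_d.+1] ++
  [seq relation i j | i <- index_enum 'I_d.+1, j <- index_enum 'I_d.+1].
have [a aF] := rcf_transfer iota z F.
pose b v := a (enum_rank v).
have evb v : (X v).@[a] = b v by rewrite /X mevalXU.
exists (fun i => b (inl i)); split; last first.
  have -> : h.@[fun i => b (inl i)] = (lft h).@[a].
    pose u : {rmorphism {mpoly R[2 * d]} -> R} := meval a \o lft.
    pose u' : {rmorphism {mpoly R[2 * d]} -> R} := meval (fun i => b (inl i)).
    rewrite -[LHS]/(u' h) -[RHS]/(u h); apply: mpoly_morphism_ext => [r|i].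
      by rewrite /u /u' /= mmapC !mevalC.
    by rewrite /u /u' /= mmapX mmap1U mevalXU evb.
  rewrite aF ?mem_head // -[mmap _ _ _]/(ev (lft h)).
  have -> : ev (lft h) = g (f h).
    pose u : {rmorphism {mpoly R[2 * d]} -> L} := ev \o lft.
    rewrite -[LHS]/(u h) -[RHS]/((g \o f) h); apply: mpoly_morphism_ext => [r|i].
      by rewrite /u /= !mmapC.
    by rewrite /u /= mmapX mmap1U evX.
  have gpos x : 0 < x -> 0 < g x.
    by move=> x0; rewrite lt_neqAle eq_sym fmorph_eq0 gt_eqF //= gmono // ltW.
  case: (ltgtP (f h) 0) => [x0|x0|->]; last by rewrite rmorph0 !sgz0.
    by rewrite (ltr0_sgz x0) ltr0_sgz // -oppr_gt0 -rmorphN gpos // oppr_gt0.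
  by rewrite (gtr0_sgz x0) gtr0_sgz // gpos.
move=> v; apply: (@psd_of_decomposition _ _ _ _ (fun k => b (inr (inl k)))
    (fun k i => b (inr (inr (k, i))))) => [k|i j].
  have := aF (X (inr (inl k))); rewrite evb -[mmap _ _ _]/(ev _) evX /=.
  have -> : X (inr (inl k)) \in F.
    rewrite inE mem_cat; apply/orP; right; apply/orP; left.
    by apply/mapP; exists k; rewrite ?mem_index_enum.
  move=> /(_ isT) e; rewrite -sgz_ge0 e sgz_ge0; exact: gmono.
have relE (S : comNzRingType) (e : {rmorphism B -> S}) (w : V -> S) :
    (forall v, e (X v) = w v) -> e (relation i j) =
      moment_var (fun i => w (inl i)) (i + j) -
      \sum_k w (inr (inl k)) * w (inr (inr (k, i))) * w (inr (inr (k, j))).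
  move=> eX; rewrite rmorphB moment_var_morph rmorph_sum; congr (_ - _).
    by apply: eq_moment_var => k; exact: eX.
  by apply: eq_bigr => k _; rewrite !rmorphM !eX.
have relF : relation i j \in F.
  rewrite inE mem_cat; apply/orP; right; apply/orP; right.
  by apply/allpairsP; exists (i, j); rewrite !mem_index_enum.
have := aF _ relF; rewrite -[mmap _ _ _]/(ev _) (relE _ ev val_of) //.
rewrite [moment_var _ _](_ : _ = g (moment_var p (i + j))); last first.
  by rewrite moment_var_morph.
rewrite [moment_var p _]Hl rmorph_sum.
rewrite [X in sgz (_ - X)](_ : _ = \sum_k g (c k * l k i * l k j)); last first.
  by apply: eq_bigr => k _; rewrite !rmorphM.
rewrite subrr sgz0 => /eqP; rewrite sgz_eq0.
by rewrite (relE _ (meval a) b evb) subr_eq0 => /eqP.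
Qed.

(** The preordering is generated by the sums of squares and [- h]. A failure of avoidance,
    [- s ^+ (2 * m) = t - h * u], is the certificate [u * h = s ^+ (2 * m) + t]. *)
Lemma sos_certificate_or_point (R : realType) (d : nat) (h s : {mpoly R[2 * d]}) :
  (exists (p q : Theta R) (m : nat), [/\ is_sos p, is_sos q &
    p * subst_pvar h = subst_pvar s ^+ (2 * m) + q]) \/
  (exists (K : realFieldType) (f : {rmorphism {mpoly R[2 * d]} -> K}),
    [/\ forall a, sos_pred a -> 0 <= f a, f h <= 0, f s != 0
      & forall x, exists a b, f b != 0 /\ x = f a / f b]).
Proof.
pose T (x : {mpoly R[2 * d]}) :=
  exists t u, [/\ sos_pred t, sos_pred u & x = t + (- h) * u].
have [TD TM TX] := sos_pred_preordering R d.
have s0 : sos_pred (0 : {mpoly R[2 * d]}) by have := TX 0; rewrite expr0n.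
have s1 : sos_pred (1 : {mpoly R[2 * d]}) by have := TX 1; rewrite expr1n.
have pT : preordering T by apply: preordering_adjoin; exact: sos_pred_preordering.
case: (pselect (avoids_even_powers s T)) => [av|nav]; [right|left].
  have [K [f [fT fs fr]]] := preordering_residue_field pT av.
  exists K, f; split=> // [a sa|].
    by apply: fT; exists a, 0; split=> //; rewrite mulr0 addr0.
  rewrite -oppr_ge0 -rmorphN; apply: fT; exists 0, 1.
  by split=> //; rewrite mulr1 add0r.
have [m [t [u [st su e]]]] : exists m, T (- s ^+ (2 * m)).
  by apply: contrapT => h'; apply: nav => m Tm; apply: h'; exists m.
have certificate : u * h = s ^+ (2 * m) + t.
  have -> : t = - s ^+ (2 * m) + h * u by rewrite e; ring.
  by ring.
exists (subst_pvar u), (subst_pvar t), m; split; [exact: su|exact: st|].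
have := congr1 (theta_subst R d) certificate.
by rewrite (rmorphM (theta_subst R d)) (rmorphD (theta_subst R d))
  (rmorphXn (theta_subst R d)).
Qed.

Lemma nonneg_on_psd_moments (R : realType) (d : nat) (h : {mpoly R[2 * d]}) (eps : R) :
  (forall n : nat, (0 < n)%N -> forall x : 'I_n -> R,
     eps <= (realize n (subst_pvar h)).@[x]) ->
  forall a : 'I_(2 * d) -> R,
    (forall v, 0 <= quad_form (@hankel R d.+1 (moment_var a)) v) -> eps <= h.@[a].
Proof.
move=> hge a psd; rewrite leNgt; apply/negP => lt.
have [|delta d0 hd] := mpoly_continuous h a (eps := eps - h.@[a]).
  by rewrite subr_gt0.
have [n [x [n0 close]]] := psd_moments_closure (m := moment_var a) erefl psd d0.
have := hge n n0 x; rewrite realize_subst_eval.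
have := hd (fun i => (power_mean R n i.+1).@[x]) _.
rewrite ltr_norml => H; have {H}[] := andP (H _) => [i|_].
  by have := close i; rewrite moment_varS.
lra.
Qed.

Theorem theorem7p6 (R : realType) (d : nat) (hd : (0 < d)%N)
    (h : {mpoly R[2 * d]}) (f : Theta R) (hf : f = subst_pvar h) :
  ((exists2 eps : R, 0 < eps &
      forall n : nat, (0 < n)%N ->
        forall x : 'I_n -> R, eps <= (realize n f).@[x]) ->
   exists p q : Theta R, [/\ is_sos p, is_sos q & p * f = 1 + q])
  /\
  ((forall n : nat, (0 < n)%N ->
        forall x : 'I_n -> R, 0 <= (realize n f).@[x]) ->
   exists (p q : Theta R) (m : nat),
     [/\ is_sos p, is_sos q & p * f = f ^+ (2 * m) + q]).
Proof.
rewrite {f}hf; split=> [[eps eps0 hge]|hge].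
  have [[p [q [m [sp sq e]]]]|[K [f [fsos fh _ fr]]]] := sos_certificate_or_point h 1.
    exists p, q; split=> //; rewrite e; congr (_ + _).
    by rewrite -theta_substE rmorph1 expr1n.
  have [a [psd sgh]] := real_moment_point h fsos fr.
  have := nonneg_on_psd_moments hge psd.
  rewrite leNgt => /negP[]; apply: le_lt_trans eps0.
  by rewrite -sgz_le0 sgh sgz_le0.
(* Taking [s = h] makes [f h] nonzero, so the real point has [h] strictly negative, against the
   bound 0. *)
have [//|[K [f [fsos fh fs fr]]]] := sos_certificate_or_point h h.
have [a [psd sgh]] := real_moment_point h fsos fr.
have := nonneg_on_psd_moments hge psd.
by rewrite leNgt -sgz_lt0 sgh sgz_lt0 lt_neqAle fs fh.
Qed.
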